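(* Let $k-m=1$ with $k\ge1$, let $\mathcal S$ be any self-adjoint positive-definite operator on $\mathbb S^k$, and put $$\mathcal C=\mathcal S^{-1/2}(\mathbb S_+^k),\qquad \mathcal D=\mathcal S^{-1/2}(\mathcal K_{k-1}^k)=\partial\mathcal C.$$ For every $\mu\in\mathcal D$ and every standard Gaussian $Y$ in $\mathbb S^k$, $$\operatorname{dist}_F^2(Y+\mu,\mathcal D)-\operatorname{dist}_F^2(Y+\mu,\mathcal C)\preceq_{\mathrm{st}}(Z_+)^2,\qquad Z\sim N(0,1).$$ Indeed, the two variables can be coupled so that the left-hand side is at most $(Z_+)^2$ almost surely. Thus, whenever $q-r=1$, top-stratum calibration controls all local null transitions without an isotropy assumption: for every $0\le s\le r$, with $k=q-s$ and $m=r-s=k-1$, and every self-adjoint positive-definite operator $\mathcal S$ on $\mathbb S^k$, every statistic $\operatorname{dist}_F^2(Y+\mu,\mathcal D)-\operatorname{dist}_F^2(Y+\mu,\mathcal C)$ with $\mu\in\mathcal D$ is stochastically dominated by the top-stratum ($s=r$) limit law, which is the law of $(Z_+)^2$.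
   Context: $\mathbb S^k$ is the space of real symmetric $k\times k$ matrices with the Frobenius inner product and norm, $\mathbb S_+^k$ its positive-semidefinite cone, $\mathcal K_m^k=\{B\in\mathbb S_+^k:\operatorname{rank}(B)\le m\}$, $\operatorname{dist}_F(X,A)=\inf_{Z\in A}\|X-Z\|_F$, $\partial\mathcal C$ is the topological boundary in $\mathbb S^k$, and $x_+=\max(x,0)$. A standard Gaussian matrix in $\mathbb S^k$ has independent $N(0,1)$ coordinates in the Frobenius-orthonormal basis $E_{ii}$, $F_{ij}=(E_{ij}+E_{ji})/\sqrt2$, $i<j$. $X\preceq_{\mathrm{st}}Y$ means $\Pr(X>t)\le\Pr(Y>t)$ for every real $t$. In the application, one tests $\operatorname{rank}(\Sigma)\le r$ for a positive-semidefinite $q\times q$ matrix $\Sigma$, $0\le r<q$. At a null point of rank $s\le r$, the limiting likelihood-ratio statistic along a local null rank transition is $\operatorname{dist}_F^2(Y+\mu,\mathcal D)-\operatorname{dist}_F^2(Y+\mu,\mathcal C)$ with $k=q-s$, $m=r-s$, $\mathcal C=\mathcal S^{-1/2}(\mathbb S_+^k)$, $\mathcal D=\mathcal S^{-1/2}(\mathcal K_m^k)$ for a model-dependent self-adjoint positive-definite operator $\mathcal S$ on $\mathbb S^k$ and a drift $\mu\in\mathcal D$; the top-stratum limit law is the case $s=r$ (so $m=0$, $\mathcal D=\{0\}$, $\mu=0$). *)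

(* Defs.v *)
From HB Require Import structures.
From mathcomp Require Import all_boot all_order all_algebra.
From mathcomp Require Import all_classical all_reals all_analysis.

Set Implicit Arguments.
Unset Strict Implicit.
Unset Printing Implicit Defensive.
Import Order.TTheory GRing.Theory Num.Theory.
Import numFieldNormedType.Exports.
Local Open Scope classical_set_scope.
Local Open Scope ring_scope.

(* S^k as a vector space in its own right, so that an operator on S^k is
   exactly an element of 'End(symmat R k). *)
Notation symmat R k := (subvs_of (fixedSpace (linfun (@trmx R k k)))).

Section SymmetricMatrices.
Context (R : realType).
Local Notation symmat k := (symmat R k).

Definition mat_of k (X : symmat k) : 'M[R]_k := vsval X.

Definition frob k (A B : 'M[R]_k) : R := \tr (A^T *m B).

Definition frob_dot k (X Y : symmat k) : R := frob (mat_of X) (mat_of Y).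

Definition frob_norm k (X : symmat k) : R := Num.sqrt (frob_dot X X).

Definition dist_F k (X : symmat k) (A : set (symmat k)) : R :=
  inf [set frob_norm (X - Z) | Z in A].

Definition psd_cone k : set (symmat k) :=
  [set B | forall v : 'cV[R]_k, 0 <= (v^T *m mat_of B *m v) 0 0].

Definition psd_rank_le (m k : nat) : set (symmat k) :=
  [set B | psd_cone B /\ (\rank (mat_of B) <= m)%N].

(* S^k carries the topology induced from 'M[R]_k, which is the topology of the
   Frobenius norm. *)
Definition sym_boundary k (A : set (symmat k)) : set (symmat k) :=
  let A' : set (initial_topology (@mat_of k)) := A in
  closure A' `\` interior A'.

Definition self_adjoint k (S : 'End(symmat k)) : Prop :=
  forall X Y : symmat k, frob_dot (S X) Y = frob_dot X (S Y).

Definition positive_definite k (S : 'End(symmat k)) : Prop :=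
  forall X : symmat k, X != 0 -> 0 < frob_dot (S X) X.

(* S^{-1/2}: the unique self-adjoint positive-definite T with T^2 S = id; the
   default value 0 is irrelevant when S is self-adjoint positive definite. *)
Definition inv_sqrt k (S : 'End(symmat k)) : 'End(symmat k) :=
  xget 0 [set T : 'End(symmat k) |
    [/\ self_adjoint T, positive_definite T & (T \o T \o S = \1)%VF]].

Definition cone_C k (S : 'End(symmat k)) : set (symmat k) :=
  inv_sqrt S @` @psd_cone k.

Definition cone_D (m k : nat) (S : 'End(symmat k)) : set (symmat k) :=
  inv_sqrt S @` @psd_rank_le m k.

Definition lr_stat (m k : nat) (S : 'End(symmat k)) (X : symmat k) : R :=
  dist_F X (cone_D m S) ^+ 2 - dist_F X (cone_C S) ^+ 2.

Definition upper_index (k : nat) := {p : 'I_k * 'I_k | (p.1 <= p.2)%N}.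

Definition sym_basis k (p : upper_index k) : 'M[R]_k :=
  let: (i, j) := val p in
  if i == j then delta_mx i i
  else (Num.sqrt 2)^-1 *: (delta_mx i j + delta_mx j i).

End SymmetricMatrices.

Section Probability.
Context (R : realType).

Definition std_normal d (T : measurableType d) (P : probability T R)
    (X : T -> R) : Prop :=
  measurable_fun setT X /\
  forall A, measurable A -> P (X @^-1` A) = normal_prob (0 : R) 1 A.

Definition mutually_independent d (T : measurableType d) (P : probability T R)
    (I : finType) (X : I -> T -> R) : Prop :=
  forall (J : {set I}) (A : I -> set R),
    (forall i, measurable (A i)) ->
    P (\bigcap_(i in [set` J]) X i @^-1` A i) =
    (\prod_(i in J) P (X i @^-1` A i))%E.

Definition std_gaussian d (T : measurableType d) (P : probability T R)
    k (Y : T -> symmat R k) : Prop :=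
  let coord (p : upper_index k) := fun w => frob (sym_basis R p) (mat_of (Y w)) in
  (forall p, std_normal P (coord p)) /\ mutually_independent P coord.

(* In the next three definitions the two variables may live on different
   probability spaces. A measure of the library is also defined, with junk
   values, on non-measurable sets; hence the measurability clauses. *)
Definition st_le d (T : measurableType d) (P : probability T R) (X : T -> R)
    d' (T' : measurableType d') (P' : probability T' R) (X' : T' -> R) : Prop :=
  [/\ measurable_fun setT X, measurable_fun setT X' &
    forall t : R, (P [set w | (t < X w)%R] <= P' [set w | (t < X' w)%R])%E].

Definition same_law d (T : measurableType d) (P : probability T R) (X : T -> R)
    d' (T' : measurableType d') (P' : probability T' R) (X' : T' -> R) : Prop :=
  [/\ measurable_fun setT X, measurable_fun setT X' &
    forall A, measurable A -> P (X @^-1` A) = P' (X' @^-1` A)].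

Definition coupled_le d (T : measurableType d) (P : probability T R) (X : T -> R)
    d' (T' : measurableType d') (P' : probability T' R) (X' : T' -> R) : Prop :=
  exists (d0 : measure_display) (W : measurableType d0) (Q : probability W R)
    (U V : W -> R),
    [/\ same_law Q U P X, same_law Q V P' X' & {ae Q, forall w, U w <= V w}].

Definition pos_part (x : R) : R := Num.max x 0.

End Probability.

(* Main.v *)
Require Import Defs.
From HB Require Import structures.
From mathcomp Require Import all_boot all_order all_algebra.
From mathcomp Require Import all_classical all_reals all_analysis.
From mathcomp Require Import measurable_realfun.
From mathcomp Require Import complex spectral.
From mathcomp Require Import ring lra zify.

(** Write C = S^{-1/2}(PSD) and D for the image of the singular positive
    semidefinite matrices. When k - m = 1 the rank bound only says that a matrix
    is singular, so D is the boundary of the closed convex cone C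
    ([cone_D_boundary]), and the statistic is an elementary function of the
    position of X = Y + mu.

    If X lies outside C, then the segment from X to any point of C crosses D, so
    the two distances are equal ([dist_outside]) and the statistic is zero. If X
    lies in C, the statistic is the squared distance from X to the boundary. The
    drift mu is a boundary point: mu = S^{-1/2} M with M v = 0 for some nonzero v,
    and n, proportional to S^{1/2}(v v^T), is a unit normal of a hyperplane that
    supports C at mu. Walking from X along - n for the length <n, X> one reaches
    that hyperplane, and so leaves the interior of C; hence the distance to D is
    at most <n, X> ([dist_inside]). As <n, mu> = 0, in both cases

      statistic <= (<n, Y>_+)^2   pointwise   ([lr_stat_le]),

    and <n, Y> is standard normal because n is a unit vector. This inequality is
    itself a coupling, from which stochastic domination follows
    ([lr_stat_dominated]). In the top stratum k = 1 and m = 0, and the inequality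
    is an equality with n the single basis matrix ([lr_stat_dim1]), so the limit
    law there is that of (Z_+)^2.

    The geometric core is [psd_boundary_crossing], which follows the segment up
    to the last time it is positive semidefinite and uses that the positive
    definite matrices are open ([psd_unit_open]). The supporting facts are the
    existence of S^{-1/2} ([inv_sqrt_exists]), obtained from the complex spectral
    theorem by polynomial interpolation; the normality of a unit linear
    combination of independent standard normal variables ([std_normal_lincomb]),
    proved by completing the square in a two-dimensional Gaussian integral and by
    induction on the number of variables; and the measurability of the distance
    functions, which are Lipschitz ([measurable_lipschitz]). *)

Set Implicit Arguments.
Unset Strict Implicit.
Unset Printing Implicit Defensive.
Import Order.TTheory GRing.Theory Num.Theory.
Import numFieldNormedType.Exports.
Local Open Scope classical_set_scope.
Local Open Scope ring_scope.

(** * Inverse square roots of positive definite matrices *)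

Section MatrixSquareRoot.

Lemma interpolation (F : fieldType) (f : F -> F) (s : seq F) :
  exists q : {poly F}, {in s, forall x, q.[x] = f x}.
Proof.
elim: s => [|x s [q qf]]; first by exists 0.
have [xs|xs] := boolP (x \in s).
  by exists q => y; rewrite inE => /orP[/eqP->|]; exact: qf.
pose w := \prod_(y <- s) ('X - y%:P).
have w0 : w.[x] != 0 by have := root_prod_XsubC s x; rewrite /root (negbTE xs) => ->.
exists (q + ((f x - q.[x]) / w.[x]) *: w) => y; rewrite inE hornerD hornerZ.
move=> /orP[/eqP->|ys]; first by rewrite divfK// addrC subrK.
have /rootP -> : root w y by rewrite root_prod_XsubC.
by rewrite mulr0 addr0 qf.
Qed.

(** Functional calculus by polynomials: a polynomial in a symmetric real matrix
    stays real and symmetric, whatever field diagonalises the matrix. *)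
Lemma trmx_horner_mx (F : comNzRingType) n (A : 'M[F]_n.+1) (p : {poly F}) :
  A^T = A -> (horner_mx A p)^T = horner_mx A p.
Proof.
move=> symA; elim/poly_ind: p => [|p c IH]; first by rewrite rmorph0 trmx0.
rewrite rmorphD rmorphM /= horner_mx_C horner_mx_X linearD /= tr_scalar_mx.
by rewrite trmx_mul IH symA (comm_mx_horner p (erefl (A *m A))).
Qed.

Context (R : realType).

Definition posdef_mx n (A : 'M[R]_n) :=
  forall v : 'rV[R]_n, v != 0 -> 0 < (v *m A *m v^T) 0 0.

Lemma dotmx_ge0 n (v : 'rV[R]_n) : 0 <= (v *m v^T) 0 0.
Proof. by rewrite mxE sumr_ge0// => i _; rewrite !mxE -expr2 sqr_ge0. Qed.

Lemma dotmx_gt0 n (v : 'rV[R]_n) : v != 0 -> 0 < (v *m v^T) 0 0.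
Proof.
move=> v0; rewrite lt0r dotmx_ge0 andbT; apply: contra_neq v0 => /eqP.
rewrite mxE psumr_eq0 => [/allP H|i _]; last by rewrite !mxE -expr2 sqr_ge0.
apply/rowP => i; have /eqP := H i (mem_index_enum _).
by rewrite !mxE => /eqP; rewrite mulf_eq0 orbb => /eqP.
Qed.

Local Notation toC := (real_complex R).

(** As [A] is real, the real and imaginary parts of a complex left eigenvector
    with a real eigenvalue are themselves eigenvectors (or zero), so a real
    quadratic form can be tested on them. *)
Lemma map_Re_mul n (u : 'rV[R[i]%C]_n) (A : 'M[R]_n) :
  map_mx (@complex.Re R) (u *m map_mx toC A) = map_mx (@complex.Re R) u *m A.
Proof.
apply/rowP => j; rewrite !mxE raddf_sum; apply: eq_bigr => i _.
by rewrite !mxE; case: (u 0 i) => a b /=; rewrite mulr0 subr0.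
Qed.

Lemma map_Im_mul n (u : 'rV[R[i]%C]_n) (A : 'M[R]_n) :
  map_mx (@complex.Im R) (u *m map_mx toC A) = map_mx (@complex.Im R) u *m A.
Proof.
apply/rowP => j; rewrite !mxE raddf_sum; apply: eq_bigr => i _.
by rewrite !mxE; case: (u 0 i) => a b /=; rewrite mulr0 add0r.
Qed.

Lemma posdef_eigenvalue_gt0 n (A : 'M[R]_n) (u : 'rV[R[i]%C]_n) (l : R) :
  posdef_mx A -> u != 0 -> u *m map_mx toC A = toC l *: u -> 0 < l.
Proof.
move=> pdA u0 uA.
have key (a : 'rV[R]_n) : a *m A = l *: a -> a != 0 -> 0 < l.
  move=> aA a0; have := pdA _ a0; rewrite aA -scalemxAl mxE.
  by rewrite pmulr_lgt0// dotmx_gt0.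
have [a0|a0] := eqVneq (map_mx (@complex.Re R) u) 0.
  apply: (key (map_mx (@complex.Im R) u)).
    rewrite -map_Im_mul uA; apply/rowP => i; rewrite !mxE.
    by case: (u 0 i) => x y /=; rewrite mul0r addr0.
  apply: contra_neq u0 => b0; apply/rowP => i.
  have := congr1 (fun M : 'rV[R]_n => M 0 i) a0.
  have := congr1 (fun M : 'rV[R]_n => M 0 i) b0.
  by rewrite !mxE; case: (u 0 i) => x y /= -> ->.
apply: key a0; rewrite -map_Re_mul uA; apply/rowP => i; rewrite !mxE.
by case: (u 0 i) => x y /=; rewrite mul0r subr0.
Qed.

Lemma symmetric_diagonalizable n (A : 'M[R]_n) : A^T = A -> posdef_mx A ->
  exists (P : 'M[R[i]%C]_n) (l : 'rV[R]_n), [/\ P \in unitmx,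
    map_mx toC A = invmx P *m diag_mx (map_mx toC l) *m P & forall i, 0 < l 0 i].
Proof.
move=> symA pdA.
pose AC := map_mx toC A.
have hermA : AC \is hermsymmx.
  apply: realsym_hermsym.
    by rewrite qualifE /= expr0 scale1r map_mx_id // /AC map_trmx symA.
  apply/mxOverP => i j; rewrite mxE; apply/CrealP; rewrite /=.
  by apply/eqP; rewrite eq_complex /= oppr0 !eqxx.
have /orthomx_spectralP := hermitian_normalmx hermA.
have dreal := hermitian_spectral_diag_real hermA.
set P := spectralmx AC; set dg := spectral_diag AC => AE.
have Pu : P \in unitmx by exact: spectral_unit.
pose l := map_mx (@complex.Re R) dg.
have dE : dg = map_mx toC l.
  apply/rowP => i; rewrite !mxE.
  by rewrite RRe_real//; exact: (mxOverP dreal).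
exists P, l; split; [exact: Pu|by rewrite -dE; exact: AE|move=> i].
 apply: (posdef_eigenvalue_gt0 pdA (u := row i P)).
  apply/negP => /eqP Pi; have := congr1 (row i) (mulmxV Pu).
  rewrite row_mul Pi mul0mx => /rowP /(_ i); rewrite !mxE eqxx => /eqP.
  by rewrite eq_sym oner_eq0.
rewrite -row_mul -/AC AE -mulmxA mulKVmx// row_mul row_diag_mx -scalemxAl -rowE.
by rewrite dE mxE.
Qed.

(** Diagonalise over the complex numbers and let [q] interpolate
    x |-> x ^ (-1/4) at the (positive) eigenvalues. Then [q ^ 4 * 'X] is 1 on
    the spectrum, so the real matrix [Q = q(A)] satisfies Q^4 A = 1. Taking the
    fourth root rather than the square root makes [Q * Q] visibly positive. *)
Lemma posdef_inv_sqrt n (A : 'M[R]_n) : A^T = A -> posdef_mx A ->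
  exists B : 'M[R]_n, [/\ B^T = B, posdef_mx B & B *m B *m A = 1%:M].
Proof.
case: n A => [|n] A symA pdA.
  exists 0; split; last by apply/matrixP => -[].
    by apply/matrixP => -[].
  by move=> v /negP[]; apply/eqP/rowP => -[].
have [P [l [Pu AE l0]]] := symmetric_diagonalizable symA pdA.
have [q qE] := interpolation (fun x => (Num.sqrt (Num.sqrt x))^-1)
  [seq l 0 i | i <- enum 'I_n.+1].
pose Q := horner_mx A q.
have Q4 : Q *m Q *m (Q *m Q) *m A = 1%:M.
  have -> : Q *m Q *m (Q *m Q) *m A = horner_mx A (q * q * (q * q) * 'X).
    by rewrite !rmorphM /= horner_mx_X.
  apply: (@map_mx_inj _ _ toC); rewrite map_horner_mx AE.
  rewrite horner_mx_uconjC // horner_mx_diag map_mx1.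
  have -> : map_mx (horner (map_poly toC (q * q * (q * q) * 'X))) (map_mx toC l) = const_mx 1.
    apply/rowP => i; rewrite !mxE horner_map /= !hornerM hornerX qE; last first.
      by apply/mapP; exists i; rewrite ?mem_enum.
    set s := Num.sqrt _; have s4 : l 0 i = s ^+ 4.
      by rewrite (exprM _ 2 2) !sqr_sqrtr ?sqrtr_ge0// ltW.
    rewrite s4; have s0 : s != 0 by rewrite gt_eqF// !sqrtr_gt0.
    by rewrite [X in toC X](_ : _ = 1) ?rmorph1//; field.
  by rewrite diag_const_mx mulmx1 mulVmx.
have symQ : Q^T = Q by exact: trmx_horner_mx.
exists (Q *m Q); split => //; first by rewrite trmx_mul symQ.
move=> v v0; have -> : v *m (Q *m Q) *m v^T = (v *m Q) *m (v *m Q)^T.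
  by rewrite trmx_mul symQ !mulmxA.
apply: dotmx_gt0; apply: contra_neq v0 => vQ.
by rewrite -(mulmx1 v) -Q4 !mulmxA vQ !mul0mx.
Qed.

End MatrixSquareRoot.
(** * The Euclidean space of symmetric matrices *)

Section FrobeniusSpace.
Context (R : realType) (k : nat).
Local Notation V := (symmat R k).
Implicit Types X Y Z : V.

Lemma frobE (A B : 'M[R]_k) : frob A B = \sum_i \sum_j A i j * B i j.
Proof.
rewrite /frob /mxtrace exchange_big; apply: eq_bigr => i _.
by rewrite mxE; apply: eq_bigr => j _; rewrite mxE.
Qed.

Lemma mat_of_sym X : (mat_of X)^T = mat_of X.
Proof. by have /fixedSpaceP := valP X; rewrite lfunE. Qed.

Lemma mat_ofE X i j : mat_of X i j = mat_of X j i.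
Proof. by rewrite -[in LHS]mat_of_sym mxE. Qed.

Definition sym_of (A : 'M[R]_k) : V := vsproj _ A.

Lemma sym_ofK (A : 'M[R]_k) : A^T = A -> mat_of (sym_of A) = A.
Proof. by move=> symA; apply: vsprojK; apply/fixedSpaceP; rewrite lfunE. Qed.

Lemma mat_of_inj : injective (@mat_of R k).
Proof. exact: val_inj. Qed.

Lemma mat_ofD X Y : mat_of (X + Y) = mat_of X + mat_of Y.
Proof. exact: raddfD. Qed.

Lemma mat_ofB X Y : mat_of (X - Y) = mat_of X - mat_of Y.
Proof. exact: raddfB. Qed.

Lemma mat_ofZ (a : R) X : mat_of (a *: X) = a *: mat_of X.
Proof. exact: linearZ. Qed.

Lemma frob_dotC X Y : frob_dot X Y = frob_dot Y X.
Proof.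
rewrite /frob_dot !frobE; apply: eq_bigr => i _; apply: eq_bigr => j _.
by rewrite mulrC.
Qed.

Lemma frob_dotDl X Y Z : frob_dot (X + Y) Z = frob_dot X Z + frob_dot Y Z.
Proof. by rewrite /frob_dot /frob mat_ofD linearD mulmxDl linearD. Qed.

Lemma frob_dotZl (a : R) X Y : frob_dot (a *: X) Y = a * frob_dot X Y.
Proof. by rewrite /frob_dot /frob mat_ofZ linearZ /= -scalemxAl linearZ. Qed.

Lemma frob_dotDr X Y Z : frob_dot Z (X + Y) = frob_dot Z X + frob_dot Z Y.
Proof. by rewrite frob_dotC frob_dotDl !(frob_dotC Z). Qed.

Lemma frob_dotZr (a : R) X Y : frob_dot Y (a *: X) = a * frob_dot Y X.
Proof. by rewrite frob_dotC frob_dotZl frob_dotC. Qed.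

Lemma frob_dotBl X Y Z : frob_dot (X - Y) Z = frob_dot X Z - frob_dot Y Z.
Proof. by rewrite -scaleN1r frob_dotDl frob_dotZl mulN1r. Qed.

Lemma frob_dotBr X Y Z : frob_dot Z (X - Y) = frob_dot Z X - frob_dot Z Y.
Proof. by rewrite frob_dotC frob_dotBl !(frob_dotC Z). Qed.

Lemma frob_dot0l X : frob_dot 0 X = 0.
Proof. by rewrite -(scale0r 0) frob_dotZl mul0r. Qed.

Lemma frob_dot_sumr (I : Type) (s : seq I) (F : I -> V) X :
  frob_dot X (\sum_(i <- s) F i) = \sum_(i <- s) frob_dot X (F i).
Proof.
elim: s => [|i s IH]; first by rewrite !big_nil frob_dotC frob_dot0l.
by rewrite !big_cons frob_dotDr IH.
Qed.

Lemma frob_dot_ge0 X : 0 <= frob_dot X X.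
Proof.
rewrite /frob_dot frobE; apply: sumr_ge0 => i _; apply: sumr_ge0 => j _.
by rewrite -expr2 sqr_ge0.
Qed.

Lemma frob_entry_le X i j : mat_of X i j ^+ 2 <= frob_dot X X.
Proof.
rewrite /frob_dot frobE (bigD1 i)//= (bigD1 j)//= -expr2 -addrA lerDl.
by rewrite addr_ge0// sumr_ge0// => a _; rewrite ?sumr_ge0// -?expr2 ?sqr_ge0// => b _;
  rewrite -expr2 sqr_ge0.
Qed.

Lemma frob_dot_eq0 X : (frob_dot X X == 0) = (X == 0).
Proof.
apply/eqP/eqP => [X0|->]; last by rewrite frob_dot0l.
apply: mat_of_inj; apply/matrixP => i j; rewrite [RHS]mxE.
by apply/eqP; rewrite -sqrf_eq0 eq_le sqr_ge0 -X0 frob_entry_le.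
Qed.

Lemma frob_norm_ge0 X : 0 <= frob_norm X.
Proof. exact: sqrtr_ge0. Qed.

Lemma frob_normE X : frob_norm X ^+ 2 = frob_dot X X.
Proof. by rewrite sqr_sqrtr// frob_dot_ge0. Qed.

Lemma frob_norm_eq0 X : (frob_norm X == 0) = (X == 0).
Proof. by rewrite -sqrf_eq0 frob_normE frob_dot_eq0. Qed.

Lemma frob_normZ (a : R) X : frob_norm (a *: X) = `|a| * frob_norm X.
Proof.
by rewrite /frob_norm frob_dotZl frob_dotZr mulrA -expr2 sqrtrM ?sqr_ge0// sqrtr_sqr.
Qed.

Lemma frob_norm0 : frob_norm (0 : V) = 0.
Proof. by apply/eqP; rewrite frob_norm_eq0. Qed.

Lemma frob_norm_distC X Y : frob_norm (X - Y) = frob_norm (Y - X).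
Proof. by rewrite -opprB -scaleN1r frob_normZ normrN1 mul1r. Qed.

Lemma frob_cauchy_schwarz X Y : frob_dot X Y <= frob_norm X * frob_norm Y.
Proof.
have [->|Y0] := eqVneq Y 0; first by rewrite frob_dotC frob_dot0l frob_norm0 mulr0.
have nY : 0 < frob_norm Y by rewrite lt0r frob_norm_eq0 Y0 frob_norm_ge0.
have := frob_dot_ge0 (frob_norm Y *: X - (frob_dot X Y / frob_norm Y) *: Y).
rewrite frob_dotBl !frob_dotBr !frob_dotZl !frob_dotZr (frob_dotC Y X) -!frob_normE.
set d := frob_dot X Y; set x := frob_norm X; set y := frob_norm Y in nY *.
have -> : y * (y * x ^+ 2) - y * (d / y * d) -
  (d / y * (y * d) - d / y * (d / y * y ^+ 2)) =
  (x * y) ^+ 2 - d ^+ 2 by field; rewrite gt_eqF.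
rewrite subr_ge0 => le; have [d0|d0] := ltP 0 d.
  by rewrite -ler_sqr ?nnegrE ?(ltW d0) ?mulr_ge0 ?frob_norm_ge0.
by rewrite (le_trans d0)// mulr_ge0 ?frob_norm_ge0.
Qed.

Lemma frob_normD X Y : frob_norm (X + Y) <= frob_norm X + frob_norm Y.
Proof.
rewrite -ler_sqr ?nnegrE ?addr_ge0 ?frob_norm_ge0//.
rewrite sqrrD !frob_normE frob_dotDl !frob_dotDr (frob_dotC Y X).
have := frob_cauchy_schwarz X Y; lra.
Qed.

Lemma frob_norm_triangle X Y Z :
  frob_norm (X - Z) <= frob_norm (X - Y) + frob_norm (Y - Z).
Proof. by rewrite -(subrKA Y X) frob_normD. Qed.

Definition basis_sym (p : upper_index k) : V := sym_of (sym_basis R p).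

Lemma basis_symE p : mat_of (basis_sym p) = sym_basis R p.
Proof.
apply: sym_ofK; rewrite /sym_basis; case: (val p) => i j.
case: eqVneq => [->|_]; first by rewrite trmx_delta.
by rewrite linearZ linearD /= !trmx_delta addrC.
Qed.

(** Both off-diagonal entries of a symmetric matrix contribute to its
    coordinate on the basis vector of [(i, j)], whence the factor sqrt 2. *)
Definition coord_weight (p : 'I_k * 'I_k) : R := if p.1 == p.2 then 1 else Num.sqrt 2.

Lemma frob_delta (i j : 'I_k) (A : 'M[R]_k) : frob (delta_mx i j) A = A i j.
Proof.
rewrite frobE (bigD1 i)//= (bigD1 j)//= mxE !eqxx mul1r !big1 ?addr0//.
  by move=> a ai; apply: big1 => b _; rewrite mxE (negbTE ai) mul0r.
by move=> b bj; rewrite mxE (negbTE bj) andbF mul0r.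
Qed.

Lemma coordE (p : upper_index k) X :
  frob (sym_basis R p) (mat_of X) = coord_weight (val p) * mat_of X (val p).1 (val p).2.
Proof.
rewrite /sym_basis /coord_weight; case: (val p) => i j /=.
case: eqVneq => [->|_]; first by rewrite frob_delta mul1r.
rewrite /frob linearZ /= -scalemxAl linearZ /= linearD mulmxDl linearD /=.
rewrite -!/(frob _ _) !frob_delta (mat_ofE X j i).
have s20 : Num.sqrt 2 != 0 :> R by rewrite sqrtr_eq0 -ltNge.
have -> : mat_of X i j + mat_of X i j = Num.sqrt 2 ^+ 2 * mat_of X i j.
  by rewrite sqr_sqrtr//; ring.
by field.
Qed.

(** Parseval's identity. The sum over all entries is folded along the diagonal:
    each strictly upper entry stands for itself and for its transpose. *)
Lemma frob_dot_coord X Y : frob_dot X Y =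
  \sum_p frob (sym_basis R p) (mat_of X) * frob (sym_basis R p) (mat_of Y).
Proof.
under eq_bigr do rewrite !coordE mulrACA.
rewrite -(big_sub _ (fun q : 'I_k * 'I_k => coord_weight q * coord_weight q *
   (mat_of X q.1 q.2 * mat_of Y q.1 q.2))) /=.
set f := fun i j => mat_of X i j * mat_of Y i j.
have -> : frob_dot X Y = \sum_(q : 'I_k * 'I_k) f q.1 q.2.
  by rewrite /frob_dot frobE pair_bigA.
rewrite (bigID (fun q : 'I_k * 'I_k => (q.1 <= q.2)%N)) /=.
rewrite [X in _ + X](reindex_inj (h := fun q => (q.2, q.1))) /=; last first.
  by move=> [a b] [c d] [-> ->].
rewrite [X in _ + X](eq_bigl (fun q : 'I_k * 'I_k => (q.1 < q.2)%N)); last first.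
  by move=> q; rewrite /= -ltnNge.
rewrite (eq_bigr (fun q : 'I_k * 'I_k => f q.1 q.2)); last first.
  by [].
have -> : \sum_(q : 'I_k * 'I_k | (q.1 < q.2)%N) f q.2 q.1 =
    \sum_(q : 'I_k * 'I_k | (q.1 <= q.2)%N) (if q.1 == q.2 then 0 else f q.1 q.2).
  rewrite [RHS]big_mkcond [LHS]big_mkcond; apply: eq_bigr => -[i j] _ /=.
  rewrite ltn_neqAle val_eqE; case: (eqVneq i j) => [->|ij] /=; first by rewrite leqnn.
  by case: ifP => // _; rewrite /f !(mat_ofE _ j i).
rewrite -big_split; apply: eq_bigr => -[i j] _ /=; rewrite /coord_weight /=.
case: eqVneq => _; first by rewrite addr0 !mul1r.
by rewrite -expr2 sqr_sqrtr// -mulr2n mulr_natl.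
Qed.

Lemma basis_orthonormal p q : frob_dot (basis_sym p) (basis_sym q) = (p == q)%:R.
Proof.
rewrite /frob_dot basis_symE coordE basis_symE /coord_weight /sym_basis.
have -> : (p == q) = (val p == val q) by [].
move: (valP p) (valP q); case: (val p) => i j; case: (val q) => a b /= ij ab.
rewrite xpair_eqE.
have s20 : Num.sqrt 2 != 0 :> R by rewrite sqrtr_eq0 -ltNge.
have [eij|nij] := eqVneq i j; have [eab|nab] := eqVneq a b.
- by rewrite mul1r mxE eij eab.
- rewrite !mxE mul1r -eij; case: (eqVneq i a) => [->|_]; last by rewrite andbF addr0 mulr0.
  by rewrite (negbTE nab) addr0 mulr0.
- rewrite !mxE -eab; case: (eqVneq i a) => [<-|_]; last by rewrite mulr0.
  by rewrite eq_sym (negbTE nij) mulr0.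
- rewrite !mxE mulrA mulfV// mul1r [X in _ + X](_ : _ = 0) ?addr0//.
  case: (eqVneq i b) => [ib|//]; case: (eqVneq j a) => [ja|//].
  by move: nij; rewrite -val_eqE /= eqn_leq ij ib ja ab.
Qed.

Lemma basis_expand X : X = \sum_p frob_dot (basis_sym p) X *: basis_sym p.
Proof.
apply/eqP; rewrite -subr_eq0 -frob_dot_eq0 frob_dot_coord; apply/eqP.
apply: big1 => q _; rewrite -basis_symE -/(frob_dot _ _).
rewrite frob_dotBr frob_dot_sumr (bigD1 q)//= big1 ?addr0.
  by rewrite frob_dotZr basis_orthonormal eqxx mulr1 subrr mul0r.
move=> p pq; rewrite frob_dotZr basis_orthonormal.
by rewrite eq_sym (negbTE pq) mulr0.
Qed.

Lemma frob_norm_sum (I : Type) (s : seq I) (F : I -> V) :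
  frob_norm (\sum_(i <- s) F i) <= \sum_(i <- s) frob_norm (F i).
Proof.
elim: s => [|i s IH]; first by rewrite !big_nil frob_norm0.
by rewrite !big_cons (le_trans (frob_normD _ _))// lerD2l.
Qed.

Lemma linear_bounded (S : 'End(V)) :
  exists2 K : R, 0 < K & forall X, frob_norm (S X) <= K * frob_norm X.
Proof.
exists (\sum_p frob_norm (S (basis_sym p)) + 1).
  by rewrite ltr_wpDl// sumr_ge0// => p _; exact: frob_norm_ge0.
move=> X; rewrite mulrDl mul1r [in leLHS](basis_expand X) linear_sum.
apply: (le_trans (frob_norm_sum _ _)).
rewrite mulr_suml ler_wpDr ?frob_norm_ge0//; apply: ler_sum => p _.
rewrite linearZ frob_normZ mulrC ler_wpM2l ?frob_norm_ge0//.
have e1 : frob_norm (basis_sym p) = 1.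
  by rewrite /frob_norm basis_orthonormal eqxx sqrtr1.
have h1 := frob_cauchy_schwarz (basis_sym p) X.
have h2 := frob_cauchy_schwarz (basis_sym p) (- X).
rewrite e1 mul1r in h1 h2; rewrite ler_norml h1 andbT.
move: h2; rewrite -scaleN1r frob_dotZr frob_normZ normrN1; lra.
Qed.

End FrobeniusSpace.
(** * The operator S^{-1/2} *)

Section InverseSquareRoot.
Context (R : realType) (k : nat).
Local Notation V := (symmat R k).
Local Notation N := #|{: upper_index k}|.
Implicit Types (X Y : V) (S T : 'End(V)).

Let e (i : 'I_N) : V := basis_sym R (enum_val i).

Let phi X : 'rV[R]_N := \row_i frob_dot (e i) X.
Let psi (v : 'rV[R]_N) : V := \sum_i v 0 i *: e i.

Let frob_phi X Y : frob_dot X Y = (phi X *m (phi Y)^T) 0 0.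
Proof.
rewrite mxE frob_dot_coord (reindex (enum_val (A := {: upper_index k}))) /=; last first.
  by apply: onW_bij; exact: enum_val_bij.
by apply: eq_bigr => i _; rewrite !mxE /frob_dot !basis_symE.
Qed.

Let psiK : cancel psi phi.
Proof.
move=> v; apply/rowP => i; rewrite mxE frob_dot_sumr (bigD1 i)//= big1 ?addr0.
  by rewrite frob_dotZr basis_orthonormal eqxx mulr1.
move=> j ji; rewrite frob_dotZr basis_orthonormal (inj_eq enum_val_inj).
by rewrite eq_sym (negbTE ji) mulr0.
Qed.

Let phi_inj : injective phi.
Proof.
move=> X Y XY; apply/eqP; rewrite -subr_eq0 -frob_dot_eq0 frob_phi.
have -> : phi (X - Y) = 0.
  apply/rowP => i; rewrite !mxE frob_dotBr.
  by have /rowP /(_ i) := XY; rewrite !mxE => ->; rewrite subrr.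
by rewrite mul0mx mxE.
Qed.

(** In the orthonormal basis a self-adjoint positive definite operator becomes a
    symmetric positive definite matrix acting on row vectors from the right, so
    the matrix result applies. *)
Lemma inv_sqrt_exists S : self_adjoint S -> positive_definite S ->
  exists T, [/\ self_adjoint T, positive_definite T & (T \o T \o S = \1)%VF].
Proof.
move=> Ssa Spd.
pose A : 'M[R]_N := \matrix_(i, j) frob_dot (S (e j)) (e i).
have phiS X : phi (S X) = phi X *m A.
  apply/rowP => j; rewrite !mxE -Ssa frob_dotC frob_phi mxE.
  by apply: eq_bigr => i _; rewrite !mxE (frob_dotC (e i) (S _)).
have symA : A^T = A by apply/matrixP => i j; rewrite !mxE Ssa frob_dotC.
have pdA : posdef_mx A.
  move=> v v0; rewrite -[v]psiK -phiS -frob_phi; apply: Spd.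
  apply: contra_neq v0 => pv0; rewrite -[v]psiK pv0.
  by apply/rowP => i; rewrite !mxE frob_dotC frob_dot0l.
have [B [symB pdB BBA]] := posdef_inv_sqrt symA pdA.
have lin : linear (fun X => psi (phi X *m B)).
  move=> a X Y; apply: phi_inj; rewrite psiK.
  have phiL b X' Y' : phi (b *: X' + Y') = b *: phi X' + phi Y'.
    by apply/rowP => i; rewrite !mxE frob_dotDr frob_dotZr.
  by rewrite !phiL !psiK mulmxDl -scalemxAl.
pose F : {linear V -> V} :=
  HB.pack (fun X => psi (phi X *m B)) (GRing.isLinear.Build _ _ _ _ _ lin).
have phiT X : phi (linfun F X) = phi X *m B by rewrite lfunE /= psiK.
exists (linfun F); split.
- move=> X Y; rewrite !frob_phi !phiT trmx_mul symB.
  by rewrite mulmxA.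
- move=> X X0; rewrite frob_phi phiT; apply: pdB.
  apply: contra_neq X0 => pX; apply: phi_inj; rewrite pX.
  by apply/rowP => i; rewrite !mxE frob_dotC frob_dot0l.
- apply/lfunP => X; rewrite !comp_lfunE id_lfunE; apply: phi_inj.
  rewrite !phiT phiS -!mulmxA.
  by rewrite (mulmx1C BBA) mulmx1.
Qed.

Lemma inv_sqrtP S : self_adjoint S -> positive_definite S ->
  [/\ self_adjoint (inv_sqrt S), positive_definite (inv_sqrt S) &
   forall X, inv_sqrt S (inv_sqrt S (S X)) = X].
Proof.
move=> Ssa Spd; have [T HT] := inv_sqrt_exists Ssa Spd.
have [Tsa Tpd TTS] : [set T : 'End(V) | [/\ self_adjoint T, positive_definite T
  & (T \o T \o S = \1)%VF]] (inv_sqrt S) by apply: xgetPex; exists T.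
split=> // X; have /lfunP /(_ X) := TTS.
by rewrite !comp_lfunE id_lfunE.
Qed.

End InverseSquareRoot.
(** * The cone of positive semidefinite matrices *)

Section PsdCone.
Context (R : realType) (k : nat).
Local Notation V := (symmat R k).
Implicit Types (X Y B N : V) (u v : 'cV[R]_k).

Definition bform X u v : R := (u^T *m mat_of X *m v) 0 0.
Definition sqn v : R := (v^T *m v) 0 0.
Definition rank1 v : V := sym_of (v *m v^T).

Lemma rank1E v : mat_of (rank1 v) = v *m v^T.
Proof. by apply: sym_ofK; rewrite trmx_mul trmxK. Qed.

Lemma bform_rank1 X v : bform X v v = frob_dot (rank1 v) X.
Proof.
rewrite /frob_dot /frob rank1E trmx_mul trmxK -mulmxA mxtrace_mulC.
by rewrite trace_mx11.
Qed.

Lemma bformC X u v : bform X u v = bform X v u.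
Proof.
transitivity ((u^T *m mat_of X *m v)^T 0 0); first by rewrite mxE.
by rewrite !trmx_mul trmxK mat_of_sym mulmxA.
Qed.

Lemma bformDl X u v w : bform X (u + v) w = bform X u w + bform X v w.
Proof. by rewrite /bform linearD /= !mulmxDl mxE. Qed.

Lemma bformZl X (a : R) u v : bform X (a *: u) v = a * bform X u v.
Proof. by rewrite /bform linearZ /= -!scalemxAl mxE. Qed.

Lemma bformDr X u v w : bform X w (u + v) = bform X w u + bform X w v.
Proof. by rewrite !(bformC X w) bformDl. Qed.

Lemma bformZr X (a : R) u v : bform X v (a *: u) = a * bform X v u.
Proof. by rewrite !(bformC X v) bformZl. Qed.

Lemma sqn_gt0 v : v != 0 -> 0 < sqn v.
Proof.
move=> v0; have := dotmx_gt0 (v := v^T); rewrite trmxK; apply.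
by apply: contra_neq v0 => /(congr1 trmx); rewrite trmxK trmx0.
Qed.

Lemma sqn_ge0 v : 0 <= sqn v.
Proof. by have := dotmx_ge0 v^T; rewrite trmxK. Qed.

Lemma frob_norm_rank1 v : frob_norm (rank1 v) = sqn v.
Proof.
apply/eqP; rewrite -(eqrXn2 (n := 2)) ?frob_norm_ge0 ?sqn_ge0// frob_normE.
rewrite -bform_rank1 /bform rank1E mulmxA -mulmxA mxE big_ord1.
by rewrite expr2.
Qed.

Lemma rank1_neq0 v : v != 0 -> rank1 v != 0.
Proof. by move=> v0; rewrite -frob_norm_eq0 frob_norm_rank1 gt_eqF// sqn_gt0. Qed.

(** Cauchy-Schwarz for a possibly degenerate form. Three test vectors a u + b v
    are needed because either diagonal value may vanish. *)
Lemma psd_cauchy_schwarz X u v : psd_cone X ->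
  bform X u v ^+ 2 <= bform X u u * bform X v v.
Proof.
move=> psdX.
have key (a b : R) : 0 <= a ^+ 2 * bform X u u + 2 * a * b * bform X u v + b ^+ 2 * bform X v v.
  have : 0 <= bform X (a *: u + b *: v) (a *: u + b *: v) by exact: psdX.
  rewrite bformDl !bformDr !bformZl !bformZr (bformC X v u).
  by congr (0 <= _); ring.
have p0 : 0 <= bform X u u by exact: psdX.
have q0 : 0 <= bform X v v by exact: psdX.
move: (bform X u u) (bform X v v) (bform X u v) key p0 q0 => p q b key p0 q0.
rewrite leNgt; apply/negP => lt.
have h1 := key q (- b); have h2 := key (- b) p; have h3 := key 1 (- b).
have {}h1 : 0 <= q * (p * q - b ^+ 2) by move: h1; congr (0 <= _); ring.
have {}h2 : 0 <= p * (p * q - b ^+ 2) by move: h2; congr (0 <= _); ring.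
have lt' : p * q - b ^+ 2 < 0 by rewrite subr_lt0.
have qe : q = 0 by apply/eqP; rewrite eq_le q0 andbT -(nmulr_lge0 _ lt').
have pe : p = 0 by apply/eqP; rewrite eq_le p0 andbT -(nmulr_lge0 _ lt').
by move: h3 lt; rewrite qe pe; nra.
Qed.

Lemma psd_isotropic_kernel X v : psd_cone X -> bform X v v = 0 -> mat_of X *m v = 0.
Proof.
move=> psdX v0; apply/colP => i; rewrite [RHS]mxE.
have := psd_cauchy_schwarz (delta_mx i 0) v psdX; rewrite v0 mulr0.
rewrite -[_ <= 0]andbT -(sqr_ge0 (bform X (delta_mx i 0) v)) -eq_le sqrf_eq0 => /eqP.
by rewrite /bform trmx_delta -mulmxA -rowE mxE.
Qed.

Lemma singular_kernelP X : reflect (exists2 v : 'cV[R]_k, v != 0 & mat_of X *m v = 0)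
  (mat_of X \notin unitmx).
Proof.
apply: (iffP idP) => [|[v v0 Xv]]; last first.
  by apply: contra_neqN v0 => Xu; rewrite -[v](mulKmx Xu) Xv mulmx0.
rewrite -row_free_unit -kermx_eq0 => /rowV0Pn[u /sub_kermxP uX u0].
exists u^T; first by apply: contra_neq u0 => /(congr1 trmx); rewrite trmxK trmx0.
by rewrite -[mat_of X]trmxK -trmx_mul mat_of_sym uX trmx0.
Qed.

(** Since m = k - 1, bounding the rank by [m] means being singular; this is
    where codimension one enters. *)
Lemma psd_rank_leP (m : nat) X : (0 < k)%N -> (k - m = 1)%N ->
  psd_rank_le m X <-> psd_cone X /\ mat_of X \notin unitmx.
Proof.
move=> k0 km; rewrite /psd_rank_le /= -row_free_unit /row_free.
have -> : (\rank (mat_of X) <= m)%N = (\rank (mat_of X) != k); last by [].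
have := rank_leq_row (mat_of X); move: (\rank _) => r; lia.
Qed.

(** A positive definite [X] dominates a multiple of the identity: Cauchy-Schwarz
    for [X] between [v] and X^-1 v gives
    |v|^4 <= (v^T X v) (v^T X^-1 v) <= (v^T X v) |X^-1| |v|^2.
    A perturbation smaller than 1 / |X^-1| therefore stays in the cone. *)
Lemma psd_unit_open X : psd_cone X -> mat_of X \in unitmx ->
  exists2 e : R, 0 < e & forall Y, frob_norm (Y - X) < e -> psd_cone Y.
Proof.
move=> psdX Xu; pose W := sym_of (invmx (mat_of X)).
have WE : mat_of W = invmx (mat_of X) by apply: sym_ofK; rewrite trmx_inv mat_of_sym.
pose K := frob_norm W + 1; have K0 : 0 < K by rewrite ltr_wpDl ?frob_norm_ge0.
exists K^-1; first by rewrite invr_gt0.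
move=> Y YX v; rewrite -/(bform Y v v).
have [->|v0] := eqVneq v 0; first by rewrite /bform mulmx0 mxE.
have sv := sqn_gt0 v0.
have lower : sqn v <= K * bform X v v.
  have := psd_cauchy_schwarz v (mat_of W *m v) psdX.
  have -> : bform X v (mat_of W *m v) = sqn v by rewrite /bform WE -mulmxA mulKVmx.
  have -> : bform X (mat_of W *m v) (mat_of W *m v) = bform W v v.
    by rewrite /bform trmx_mul mat_of_sym WE -!mulmxA mulKVmx.
  have WK : bform W v v <= K * sqn v.
    rewrite bform_rank1 (le_trans (frob_cauchy_schwarz _ _))// frob_norm_rank1.
    by rewrite mulrC ler_pM2r// lerDl.
  have q0 : 0 <= bform X v v by exact: psdX.
  move=> le; rewrite -(ler_pM2l sv) -expr2 (le_trans le)//.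
  by rewrite mulrCA mulrA mulrC ler_wpM2r//; rewrite mulrC in WK *.
have upper : bform X v v - bform Y v v <= sqn v * frob_norm (Y - X).
  rewrite !bform_rank1 -frob_dotBr (le_trans (frob_cauchy_schwarz _ _))//.
  by rewrite frob_norm_rank1 frob_norm_distC.
have sK : sqn v / K <= bform X v v by rewrite ler_pdivrMr// mulrC.
have : sqn v * frob_norm (Y - X) <= sqn v / K by rewrite ler_pM2l// ltW.
lra.
Qed.

(** Take the last time [t0] at which the segment from [B] to [N] is still
    positive semidefinite. The quadratic forms are affine along the segment, so
    the cone is not left before [t0], and the point at [t0] is in it. If that
    point were invertible, openness would allow a later time, unless t0 = 1,
    which is excluded by the hypothesis on [N]. *)
Lemma psd_boundary_crossing B N : psd_cone B ->
  ~ (psd_cone N /\ mat_of N \in unitmx) ->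
  exists2 t : R, 0 <= t <= 1 &
    psd_cone (B + t *: (N - B)) /\ mat_of (B + t *: (N - B)) \notin unitmx.
Proof.
move=> psdB notN.
pose E := [set t : R | 0 <= t <= 1 /\ psd_cone (B + t *: (N - B))].
have E0 : E 0 by split; rewrite ?lexx ?ler01// scale0r addr0.
have supE : has_sup E by split; [exists 0|exists 1 => t [/andP[]]].
pose t0 := sup E.
have t0_ge0 : 0 <= t0 by apply: ub_le_sup => //; case: supE.
have t0_le1 : t0 <= 1 by apply: ge_sup => [|t [/andP[]]//]; exists 0.
have affE t v : bform (B + t *: (N - B)) v v =
    bform B v v + t * (bform N v v - bform B v v).
  by rewrite !bform_rank1 frob_dotDr frob_dotZr frob_dotBr.
have psdt0 : psd_cone (B + t0 *: (N - B)).
  move=> v; rewrite -/(bform _ v v) leNgt; apply/negP => neg.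
  have b0 : 0 <= bform B v v by exact: psdB.
  rewrite affE in neg.
  (* [s] is the slope of an affine function of time, nonnegative at 0 and
     negative at [t0]; its zero lies at distance [(b + t0 s) / s] before [t0]. *)
  set s := bform N v v - bform B v v in neg.
  have s0 : s < 0 by nra.
  have eps0 : 0 < (bform B v v + t0 * s) / s by rewrite -mulrNN -invrN divr_gt0// oppr_gt0.
  have [t [_ psdt] ltt] := sup_adherent eps0 supE.
  have : 0 <= bform (B + t *: (N - B)) v v by exact: psdt.
  rewrite affE -/s; rewrite -/t0 in ltt.
  have : (t0 - (bform B v v + t0 * s) / s) * s = - bform B v v by field; rewrite lt_eqF.
  by move: ltt; rewrite -(ltr_nM2r s0); lra.
exists t0; first by rewrite t0_ge0.
split => //; apply/negP => ut0.
have [e e0 He] := psd_unit_open psdt0 ut0.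
have [t01|t0_lt1] := eqVneq t0 1.
  by apply: notN; move: psdt0 ut0; rewrite t01 scale1r addrC subrK.
have {}t0_lt1 : t0 < 1 by rewrite lt_neqAle t0_lt1.
pose c := frob_norm (N - B) + 1.
have c0 : 0 < c by rewrite ltr_wpDl ?frob_norm_ge0.
pose t := Num.min 1 (t0 + e / c).
have tgt : t0 < t by rewrite lt_min t0_lt1 ltrDl divr_gt0.
have : E t.
  split; first by rewrite (le_trans t0_ge0 (ltW tgt)) ge_min lexx.
  apply: He; rewrite opprD addrACA subrr add0r -scalerBl frob_normZ.
  rewrite ger0_norm ?subr_ge0 ?(ltW tgt)//.
  have : t - t0 <= e / c by rewrite lerBlDl ge_min lexx orbT.
  move=> le; apply: (@le_lt_trans _ _ (e / c * frob_norm (N - B))).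
    by rewrite ler_wpM2r ?frob_norm_ge0.
  by rewrite mulrAC ltr_pdivrMr// ltr_pM2l// ltrDl.
move=> Et; have := ub_le_sup supE.2 Et; rewrite -/t0.
by rewrite leNgt tgt.
Qed.

End PsdCone.
(** * Distances to the transformed cones *)

Section Distance.
Context (R : realType) (k : nat).
Local Notation V := (symmat R k).
Implicit Types (X Y Z : V) (A : set V).

Lemma dist_has_inf X A : A !=set0 -> has_inf [set frob_norm (X - Z) | Z in A].
Proof.
move=> [Z AZ]; split; first by exists (frob_norm (X - Z)); exists Z.
by exists 0 => _ [Y _ <-]; exact: frob_norm_ge0.
Qed.

Lemma dist_le X A Z : A Z -> dist_F X A <= frob_norm (X - Z).
Proof.
by move=> AZ; apply: ge_inf; [apply: (dist_has_inf _ _).2; exists Z|exists Z].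
Qed.

Lemma dist_ge X A (c : R) : A !=set0 -> (forall Z, A Z -> c <= frob_norm (X - Z)) ->
  c <= dist_F X A.
Proof.
move=> A0 H; apply: lb_le_inf; first exact: (dist_has_inf X A0).1.
by move=> _ [Z AZ <-]; exact: H.
Qed.

Lemma dist_ge0 X A : A !=set0 -> 0 <= dist_F X A.
Proof. by move=> A0; apply: dist_ge => // Z _; exact: frob_norm_ge0. Qed.

Lemma dist_mem X A : A X -> dist_F X A = 0.
Proof.
move=> AX; apply/eqP; rewrite eq_le dist_ge0 ?andbT; last by exists X.
by have := dist_le X AX; rewrite subrr frob_norm0.
Qed.

Lemma dist_set1 X Y : dist_F X [set Y] = frob_norm (X - Y).
Proof.
apply/eqP; rewrite eq_le dist_le//=; apply: dist_ge; first by exists Y.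
by move=> _ ->.
Qed.

Lemma dist_lipschitz X Y A : A !=set0 ->
  dist_F X A <= frob_norm (X - Y) + dist_F Y A.
Proof.
move=> A0; rewrite -lerBlDl; apply: dist_ge => // Z AZ.
by rewrite lerBlDl (le_trans (dist_le X AZ))// frob_norm_triangle.
Qed.

End Distance.

Section TransformedCones.
Context (R : realType) (k m : nat) (S : 'End(symmat R k)).
Hypothesis k_gt0 : (0 < k)%N.
Hypothesis km1 : (k - m = 1)%N.
Hypothesis S_sa : self_adjoint S.
Hypothesis S_pd : positive_definite S.
Local Notation V := (symmat R k).
Implicit Types (X Y Z : V).

Let T := inv_sqrt S.
(** The inverse of [inv_sqrt S], that is the square root of [S]: it turns
    membership in the transformed cones into conditions on ordinary matrices. *)
Definition sqrt_op (X : V) : V := inv_sqrt S (S X).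
Local Notation Ti := sqrt_op.

Let T_sa : self_adjoint T. Proof. by have [] := inv_sqrtP S_sa S_pd. Qed.
Let T_pd : positive_definite T. Proof. by have [] := inv_sqrtP S_sa S_pd. Qed.

Lemma sqrt_opK X : inv_sqrt S (Ti X) = X.
Proof. by have [_ _] := inv_sqrtP S_sa S_pd; apply. Qed.

Lemma inv_sqrtK X : Ti (inv_sqrt S X) = X.
Proof.
apply/eqP; rewrite -subr_eq0; apply/negPn/negP => /T_pd.
have -> : T (Ti (inv_sqrt S X) - X) = 0.
  by rewrite linearB; apply/eqP; rewrite subr_eq0; apply/eqP; exact: sqrt_opK.
by rewrite frob_dot0l ltxx.
Qed.

Lemma sqrt_opD X Y : Ti (X + Y) = Ti X + Ti Y.
Proof. by rewrite /sqrt_op !linearD. Qed.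

Lemma sqrt_opZ (a : R) X : Ti (a *: X) = a *: Ti X.
Proof. by rewrite /sqrt_op !linearZ. Qed.

Lemma sqrt_opB X Y : Ti (X - Y) = Ti X - Ti Y.
Proof. by rewrite /sqrt_op !linearB. Qed.

Lemma sqrt_op_sa X Y : frob_dot (Ti X) Y = frob_dot X (Ti Y).
Proof. by rewrite -{1}[Y]sqrt_opK -T_sa /T sqrt_opK. Qed.

Lemma cone_CE X : cone_C S X <-> psd_cone (Ti X).
Proof.
split=> [[B psdB <-]|psdX]; first by rewrite inv_sqrtK.
by exists (Ti X) => //; exact: sqrt_opK.
Qed.

Lemma cone_DE X : cone_D m S X <-> psd_cone (Ti X) /\ mat_of (Ti X) \notin unitmx.
Proof.
rewrite -(psd_rank_leP _ k_gt0 km1).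
split=> [[B psdB <-]|psdX]; first by rewrite inv_sqrtK.
by exists (Ti X) => //; exact: sqrt_opK.
Qed.

Lemma cone_D_sub_C X : cone_D m S X -> cone_C S X.
Proof. by move=> /cone_DE[? _]; apply/cone_CE. Qed.

Lemma cone_D0 : cone_D m S 0.
Proof.
have z0 : mat_of (0 : V) = 0 by exact: raddf0.
apply/cone_DE; rewrite -(scale0r 0) sqrt_opZ scale0r z0; split.
  by move=> v; rewrite z0 mulmx0 mul0mx mxE.
by rewrite -row_free_unit /row_free mxrank0 eq_sym -lt0n.
Qed.

Lemma crossing X Z : cone_C S Z -> ~ (psd_cone (Ti X) /\ mat_of (Ti X) \in unitmx) ->
  exists2 t : R, 0 <= t <= 1 & cone_D m S (Z + t *: (X - Z)).
Proof.
move=> /cone_CE psdZ notX.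
have [t t01 Ht] := psd_boundary_crossing psdZ notX.
by exists t => //; apply/cone_DE; rewrite sqrt_opD sqrt_opZ sqrt_opB.
Qed.

(** Outside the convex cone the two distances agree: the segment from [X] to any
    point of the cone meets the boundary no farther away than that point. *)
Lemma dist_outside X : ~ cone_C S X -> dist_F X (cone_D m S) = dist_F X (cone_C S).
Proof.
move=> nCX; apply/eqP; rewrite eq_le; apply/andP; split.
  apply: dist_ge; first by exists 0; apply/cone_D_sub_C/cone_D0.
  move=> Z CZ; have [|t /andP[t0 t1] Dt] := crossing (X := X) CZ.
    by move=> [psdX _]; apply/nCX/cone_CE.
  apply: (le_trans (dist_le X Dt)).
  have -> : X - (Z + t *: (X - Z)) = (1 - t) *: (X - Z).
    by rewrite opprD addrA scalerBl scale1r.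
  by rewrite frob_normZ ger0_norm ?subr_ge0// ler_piMl ?frob_norm_ge0// gerBl.
apply: dist_ge; first by exists 0; exact: cone_D0.
by move=> Z /cone_D_sub_C CZ; exact: dist_le.
Qed.

(** The unit normal of a supporting hyperplane of the cone: [sqrt_op S] is
    self-adjoint, so the inner product with [sqrt_op S (rank1 v)] is the quadratic
    form X |-> v^T (S^{1/2} X) v, nonnegative on the cone and zero wherever [v]
    lies in the kernel. *)
Definition normal_vec (v : 'cV[R]_k) : V :=
  (frob_norm (Ti (rank1 v)))^-1 *: Ti (rank1 v).

Let Ti_rank1_gt0 (v : 'cV[R]_k) : v != 0 -> 0 < frob_norm (Ti (rank1 v)).
Proof.
move=> v0; rewrite lt0r frob_norm_ge0 frob_norm_eq0 andbT.
by apply: contra_neq (rank1_neq0 v0) => T0; rewrite -[rank1 v]sqrt_opK T0 linear0.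
Qed.

Lemma normal_vec_unit v : v != 0 -> frob_dot (normal_vec v) (normal_vec v) = 1.
Proof.
move=> v0; rewrite -frob_normE frob_normZ ger0_norm ?invr_ge0 ?frob_norm_ge0//.
by rewrite mulVf ?expr1n// gt_eqF// Ti_rank1_gt0.
Qed.

Lemma normal_vecE v X : frob_dot (normal_vec v) X =
  (frob_norm (Ti (rank1 v)))^-1 * bform (Ti X) v v.
Proof. by rewrite frob_dotZl sqrt_op_sa bform_rank1. Qed.

Lemma normal_vec_ge0 v X : cone_C S X -> 0 <= frob_dot (normal_vec v) X.
Proof.
move=> /cone_CE psdX; rewrite normal_vecE mulr_ge0 ?invr_ge0 ?frob_norm_ge0//.
exact: psdX.
Qed.

Lemma normal_vec_eq0 v X : v != 0 -> frob_dot (normal_vec v) X = 0 ->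
  bform (Ti X) v v = 0.
Proof.
move=> v0 /eqP; rewrite normal_vecE mulf_eq0 invr_eq0 gt_eqF ?Ti_rank1_gt0//=.
by move/eqP.
Qed.

Lemma isotropic_not_interior v X : v != 0 -> bform (Ti X) v v = 0 ->
  ~ (psd_cone (Ti X) /\ mat_of (Ti X) \in unitmx).
Proof.
move=> v0 Xv [psdX]; apply/negP; apply/singular_kernelP.
by exists v => //; exact: psd_isotropic_kernel.
Qed.

(** Moving from [X] in the direction opposite to the normal by the amount
    [<n, X>] reaches the supporting hyperplane, which misses the interior of the
    cone; the boundary has been met on the way. *)
Lemma dist_inside v X : v != 0 -> cone_C S X ->
  dist_F X (cone_D m S) <= frob_dot (normal_vec v) X.
Proof.
move=> v0 CX; set n := normal_vec v; set a := frob_dot n X.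
have a0 : 0 <= a by exact: normal_vec_ge0.
have nY : frob_dot n (X - a *: n) = 0.
  by rewrite frob_dotBr frob_dotZr normal_vec_unit// mulr1 subrr.
have := isotropic_not_interior v0 (normal_vec_eq0 v0 nY).
move=> /(crossing CX)[t /andP[t0 t1] Dt].
apply: (le_trans (dist_le X Dt)).
have -> : X - (X + t *: (X - a *: n - X)) = (t * a) *: n.
  by rewrite opprD addrA subrr add0r addrAC subrr add0r scalerN opprK scalerA.
have n1 : frob_norm n = 1 by rewrite /frob_norm normal_vec_unit// sqrtr1.
by rewrite frob_normZ n1 mulr1 ger0_norm ?mulr_ge0// ler_piMl.
Qed.

(** The pathwise form of the proposition. The hyperplane is chosen to support
    the cone at [mu], so that the normal does not see the drift. *)
Lemma lr_stat_le mu : cone_D m S mu ->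
  exists2 n : V, frob_dot n n = 1 &
    forall X, lr_stat m S (X + mu) <= pos_part (frob_dot n X) ^+ 2.
Proof.
move=> Dmu; have /cone_DE[psdmu /singular_kernelP[v v0 muv]] := Dmu.
exists (normal_vec v); first exact: normal_vec_unit.
move=> X; rewrite /lr_stat.
have nmu : frob_dot (normal_vec v) mu = 0.
  by rewrite normal_vecE /bform -mulmxA muv mulmx0 mxE mulr0.
have [CX|nCX] := pselect (cone_C S (X + mu)); last first.
  by rewrite dist_outside// subrr sqr_ge0.
rewrite (dist_mem CX) expr0n subr0.
have le := dist_inside v0 CX; have ge := normal_vec_ge0 v CX.
rewrite frob_dotDr nmu addr0 in le ge.
rewrite /pos_part max_l//.
rewrite ler_sqr ?nnegrE// dist_ge0//.
by exists mu.
Qed.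

End TransformedCones.
(** * The boundary of the transformed cone *)

Section Topology.
Context (R : realType) (k : nat).
Local Notation V := (symmat R k).
Local Notation VT := (initial_topology (@mat_of R k)).

(** The topology of matrices is defined entrywise; entries and the Frobenius
    norm control each other up to a factor depending on [k]. *)
Lemma nbhs_frobP (X : VT) (B : set VT) : nbhs X B <->
  exists2 e : R, 0 < e & forall Y : V, frob_norm (Y - (X : V)) < e -> B Y.
Proof.
split.
  rewrite nbhsE => -[U [oU UX] UB].
  have [Q Qo UE] : wopen (@mat_of R k) U by exact: oU.
  have : nbhs (mat_of (X : V)) Q.
    by apply: open_nbhs_nbhs; split => //; rewrite -UE in UX.
  move=> /nbhs_ballP[e /= e0 eO]; exists e => // Y YX; apply: UB; rewrite -UE.
  apply: eO; split=> [|i j]; first exact: e0.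
  rewrite /ball /= distrC.
  have -> : mat_of Y i j - mat_of (X : V) i j = mat_of (Y - (X : V)) i j.
    by rewrite mat_ofB !mxE.
  apply: le_lt_trans YX; rewrite -ler_sqr ?nnegrE ?frob_norm_ge0//.
  by rewrite frob_normE real_normK ?num_real// frob_entry_le.
move=> [e e0 He].
pose d := e / k.+1%:R; have d0 : 0 < d by rewrite divr_gt0.
have : nbhs (mat_of (X : V)) (ball (mat_of (X : V)) d) by exact: nbhsx_ballx.
move=> /(@initial_continuous _ _ (@mat_of R k) X); rewrite /= nbhs_simpl /=.
apply: filterS => Y XY; apply: He.
rewrite -ltr_sqr ?nnegrE ?frob_norm_ge0 ?(ltW e0)// frob_normE /frob_dot frobE.
apply: (@le_lt_trans _ _ (\sum_(i < k) \sum_(j < k) d ^+ 2)).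
  apply: ler_sum => i _; apply: ler_sum => j _.
  rewrite -expr2 -real_normK ?num_real// ler_sqr ?nnegrE ?(ltW d0)//.
  have -> : mat_of ((Y : V) - (X : V)) i j = mat_of (Y : V) i j - mat_of (X : V) i j.
    by rewrite mat_ofB !mxE.
  by rewrite distrC; apply: ltW; exact: XY.2.
rewrite !sumr_const card_ord -mulrnA -mulr_natr.
have -> : e ^+ 2 = d ^+ 2 * (k.+1 * k.+1)%:R.
  by rewrite natrM -expr2 -exprMn divfK// pnatr_eq0.
by rewrite ltr_pM2l ?exprn_gt0// ltr_nat ltn_mul.
Qed.

End Topology.

Section Boundary.
Context (R : realType) (k m : nat) (S : 'End(symmat R k)).
Hypothesis k_gt0 : (0 < k)%N.
Hypothesis km1 : (k - m = 1)%N.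
Hypothesis S_sa : self_adjoint S.
Hypothesis S_pd : positive_definite S.
Local Notation V := (symmat R k).
Local Notation VT := (initial_topology (@mat_of R k)).

(** The half-spaces of the normal vectors show that the cone is closed and that a
    singular point is not interior; an invertible point is interior because the
    positive definite matrices are open and the square root of [S] is bounded. *)
Lemma cone_D_boundary : cone_D m S = sym_boundary (cone_C S).
Proof.
have CE := cone_CE S_sa S_pd; have DE := cone_DE k_gt0 km1 S_sa S_pd.
apply/seteqP; split => X.
  move=> DX; split.
    by apply: subset_closure; exact: (cone_D_sub_C k_gt0 km1 S_sa S_pd DX).
  move=> /nbhs_frobP[e e0 He].
  have /DE[_ /singular_kernelP[v v0 Xv]] := DX.
  pose n := normal_vec S v.
  have n1 : frob_norm n = 1.
    by rewrite /frob_norm (normal_vec_unit S_sa S_pd v0) sqrtr1.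
  have : cone_C S (X - (e / 2) *: n).
    apply: He; rewrite addrAC subrr add0r -scaleNr frob_normZ n1 mulr1.
    by rewrite normrN ger0_norm ?divr_ge0 ?(ltW e0)//; lra.
  move=> /(normal_vec_ge0 S_sa S_pd v); rewrite -/n frob_dotBr frob_dotZr.
  rewrite (normal_vec_unit S_sa S_pd v0) mulr1 (normal_vecE S_sa S_pd).
  by rewrite /bform -mulmxA Xv mulmx0 mxE mulr0; lra.
move=> [clX intX]; apply/DE; have psdX : psd_cone (sqrt_op S X).
  move=> v; rewrite -/(bform _ v v) leNgt; apply/negP => neg.
  have v0 : v != 0 by apply: contraTneq neg => ->; rewrite /bform mulmx0 mxE ltxx.
  have nX : frob_dot (normal_vec S v) X < 0.
    rewrite (normal_vecE S_sa S_pd) pmulr_rlt0// invr_gt0 lt0r frob_norm_ge0 andbT.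
    apply: contraTneq neg => n0; rewrite -leNgt bform_rank1 -(sqrt_op_sa S_sa S_pd).
    by move/eqP: n0; rewrite frob_norm_eq0 => /eqP ->; rewrite frob_dot0l.
  have : nbhs (X : VT) [set Y : VT | frob_dot (normal_vec S v) (Y : V) < 0].
    apply/nbhs_frobP; exists (- frob_dot (normal_vec S v) X); first by rewrite oppr_gt0.
    move=> Y YX /=.
    have := frob_cauchy_schwarz (normal_vec S v) (Y - X).
    rewrite {1}/frob_norm (normal_vec_unit S_sa S_pd v0) sqrtr1 mul1r frob_dotBr.
    lra.
  move=> /clX[Y [CY /=]].
  by rewrite ltNge (normal_vec_ge0 S_sa S_pd _ CY).
split=> //; apply/negP => Xu; apply: intX; apply/nbhs_frobP.
have [e e0 He] := psd_unit_open psdX Xu.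
have [K K0 HK] := linear_bounded (inv_sqrt S \o S)%VF.
exists (e / K); first by rewrite divr_gt0.
move=> Y YX; apply/CE; apply: He; rewrite -(sqrt_opB S).
have := HK (Y - X); rewrite comp_lfunE => /le_lt_trans; apply.
by rewrite mulrC -ltr_pdivlMr.
Qed.

End Boundary.
(** * Normal laws on the line *)

(** The pushforward as a bundled measure, the measurability of the map being
    recorded in the term. *)
Definition image_measure d1 d2 (T1 : measurableType d1) (T2 : measurableType d2)
    (R : realType) (m : {measure set T1 -> \bar R}) (f : T1 -> T2)
    (mf : measurable_fun setT f) : {measure set T2 -> \bar R} :=
  measure_function_pushforward__canonical__measure_function_Measure m mf.

Section NormalLaw.
Context (R : realType).
Local Notation mu := (@lebesgue_measure R).
Local Notation gauss := (normal_prob (0 : R) 1).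

(** By uniqueness of the Lebesgue measure it is enough to check half-open
    intervals; for b < 0 these are reversed, hence the two cases. *)
Lemma lebesgue_measure_affine (m b : R) (A : set R) : b != 0 -> measurable A ->
  mu A = (`|b|%:E * mu ((fun y => m + b * y)%R @^-1` A))%E.
Proof.
move=> b0 mA.
have maff : measurable_fun setT ((fun y => m + b * y) : measurableTypeR R -> measurableTypeR R).
  by apply: measurable_realfun.measurable_funD => //; apply: measurable_funM.
pose nu := image_measure mu maff.
pose bn := NngNum (normr_ge0 b).
have := @lebesgue_measure_unique R (mscale bn nu).
apply => //= _ [[x y]] _ <-.
rewrite /mscale /= /pushforward.
have [b_gt0|b_lt0|/eqP] := ltgtP b 0; last by rewrite (negbTE b0).
  rewrite (_ : _ @^-1` _ = `[(y - m) / b, (x - m) / b[%classic); last first.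
    apply/seteqP; split => z /=; rewrite !in_itv /= ?ler_ndivrMr ?ltr_ndivlMr //; lra.
  rewrite !lebesgue_measure_itv /= !lte_fin ltr_ndivlMr // divfK // ltrD2r ltr0_norm //.
  by case: ifPn => _; rewrite ?mule0// -?EFinB -?EFinM; congr EFin; field.
rewrite (_ : _ @^-1` _ = `](x - m) / b, (y - m) / b]%classic); last first.
  apply/seteqP; split => z /=; rewrite !in_itv /= ?ler_pdivlMr ?ltr_pdivrMr //; lra.
rewrite !lebesgue_measure_itv /= !lte_fin ltr_pdivrMr // divfK // ltrD2r gtr0_norm //.
by case: ifPn => _; rewrite ?mule0// -?EFinB -?EFinM; congr EFin; field.
Qed.

Lemma normal_pdf_affine (m b y : R) : b != 0 ->
  normal_pdf 0 1 y = `|b| * normal_pdf m b (m + b * y).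
Proof.
move=> b0; rewrite !normal_pdfE ?oner_eq0// mulrA; congr (_ * _).
  rewrite /normal_peak expr1n mul1r -mulrnAr sqrtrM ?sqr_ge0// sqrtr_sqr invfM mulrA.
  by rewrite divff ?mul1r // normr_eq0.
rewrite /normal_fun; congr expR; field; exact: b0.
Qed.

Lemma normal_prob_affine (m b : R) (A : set R) : b != 0 -> measurable A ->
  gauss ((fun y => m + b * y) @^-1` A) = normal_prob m b A.
Proof.
move=> b0 mA.
have maff : measurable_fun setT ((fun y => m + b * y) : measurableTypeR R -> measurableTypeR R).
  by apply: measurable_realfun.measurable_funD => //; apply: measurable_funM.
pose nu := image_measure mu maff.
pose bn := NngNum (normr_ge0 b).
have mpdf : measurable_fun A (EFin \o normal_pdf m b).
  by apply/measurable_EFinP/measurable_funTS; exact: measurable_normal_pdf.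
rewrite /normal_prob.
transitivity (\int[mscale bn nu]_(x in A) (normal_pdf m b x)%:E)%E; last first.
  apply: eq_measure_integral => B mB _ /=.
  by rewrite (lebesgue_measure_affine m b0).
rewrite ge0_integral_mscale //; last by move=> x _; rewrite lee_fin normal_pdf_ge0.
rewrite ge0_integral_pushforward //; last by move=> x _; rewrite lee_fin normal_pdf_ge0.
rewrite -ge0_integralZl //=.
- by apply: eq_integral => x _; rewrite -EFinM -(normal_pdf_affine _ _ b0).
- by rewrite -[X in measurable X]setTI; exact (maff measurableT A mA).
- apply/measurable_EFinP/measurable_funTS.
  by apply: measurableT_comp => //; exact: measurable_normal_pdf.
- by move=> x _; rewrite lee_fin normal_pdf_ge0.
Qed.

(** Integration against a density: the density agrees almost everywhere with the
    Radon-Nikodym derivative. *)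
Lemma integral_normal_prob (m s : R) (f : R -> \bar R) :
  (normal_prob m s).-integrable setT f ->
  (\int[normal_prob m s]_x f x = \int[mu]_x (f x * (normal_pdf m s x)%:E))%E.
Proof.
move=> intf.
have mf := measurable_int _ intf.
rewrite -(Radon_Nikodym_change_of_variables (normal_prob_dominates m s))//=.
apply: ae_eq_integral => //.
- apply: emeasurable_funM => //; apply: (measurable_int mu).
  by apply: Radon_Nikodym_integrable; exact: normal_prob_dominates.
- apply: emeasurable_funM => //=; apply/measurableT_comp => //=.
  exact: measurable_normal_pdf.
- apply: ae_eqe_mul2l => /=.
  rewrite Radon_NikodymE//=; first exact: normal_prob_dominates.
  move=> dom; case: cid => /= h [h1 h2 h3].
  apply: integral_ae_eq => //=.
  + by apply/measurableT_comp => //; exact: measurable_normal_pdf.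
  + by move=> E _ mE; rewrite -h3.
Qed.

End NormalLaw.
(** * Linear combinations of independent normal variables *)

Section GaussianRotation.
Context (R : realType).
Local Notation mu := (@lebesgue_measure R).
Local Notation gauss := (normal_prob (0 : R) 1).

(** Completing the square: both sides carry the exponent
    - (x^2 - 2 a x u + u^2) / (2 b^2), which is symmetric in [x] and [u]. *)
Lemma normal_pdf_rotation (a b x u : R) : b != 0 -> a ^+ 2 + b ^+ 2 = 1 ->
  normal_pdf 0 1 x * normal_pdf (a * x) b u =
  normal_pdf 0 1 u * normal_pdf (a * u) b x.
Proof.
move=> b0 ab; rewrite !normal_pdfE ?oner_eq0// /normal_fun.
rewrite mulrACA [RHS]mulrACA -!expRD; congr (_ * expR _).
have -> : a ^+ 2 = 1 - b ^+ 2 ->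
    (x - a * u) ^+ 2 = (u - a * x) ^+ 2 + b ^+ 2 * (x ^+ 2 - u ^+ 2).
  by move=> a2; rewrite !sqrrB !exprMn a2; ring.
  by field.
by rewrite -ab addrK.
Qed.

Lemma measurable_normal_pdf2 (a b : R) : b != 0 ->
  measurable_fun setT (fun z : R * R => normal_pdf (a * z.1) b z.2).
Proof.
move=> b0; rewrite (_ : (fun z => _) = fun z : R * R => normal_pdf 0 b (z.2 - a * z.1)).
  apply: measurableT_comp; first exact: measurable_normal_pdf.
  by apply: measurable_funB => //; apply: measurable_funM.
by apply/funext => z; rewrite !normal_pdfE// /normal_fun subr0.
Qed.

(** For fixed [x], the law of a x + b Y is normal with mean a x and variance
    b^2. After Tonelli and the exchange of [x] and [u] in the densities, the inner
    integral is that of a probability density. *)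
Lemma gauss_rotation (a b : R) (A : set R) : b != 0 -> a ^+ 2 + b ^+ 2 = 1 ->
  measurable A ->
  (gauss \x gauss)%E ((fun z : R * R => a * z.1 + b * z.2) @^-1` A) = gauss A.
Proof.
move=> b0 ab mA.
have pdf_ge0 (m s x : R) : (0 <= (normal_pdf m s x)%:E)%E by rewrite lee_fin normal_pdf_ge0.
rewrite /product_measure1 /=.
have sectE (x : R) : gauss (xsection ((fun z : R * R => (a * z.1 + b * z.2)%R) @^-1` A) x)
    = (\int[mu]_u ((\1_A u)%:E * (normal_pdf (a * x) b u)%:E))%E.
  have -> : xsection ((fun z : R * R => a * z.1 + b * z.2) @^-1` A) x =
      (fun y => a * x + b * y) @^-1` A.
    by apply/seteqP; split => y /=; rewrite /xsection /= inE.
  rewrite normal_prob_affine//.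
  rewrite /normal_prob integral_mkcond; apply: eq_integral => u _.
  by rewrite patchE indicE; case: ifPn => _; rewrite ?mul1e ?mul0e.
have mind : measurable_fun setT (\1_A : R -> R) by exact: measurable_indic.
have mE : measurable ((fun z : R * R => a * z.1 + b * z.2) @^-1` A).
  have mlin : measurable_fun setT (fun z : R * R => a * z.1 + b * z.2).
    by apply: measurable_funD; apply: measurable_funM.
  by rewrite -[X in measurable X]setTI; exact: (mlin measurableT A mA).
have int1 : gauss.-integrable setT
    (gauss \o xsection ((fun z : R * R => (a * z.1 + b * z.2)%R) @^-1` A)).
  apply/integrableP; split.
    exact: measurable_fun_xsection.
  apply: (@le_lt_trans _ _ (\int[gauss]_x 1)%E).
    apply: ge0_le_integral => //=.
    - by apply: measurableT_comp => //; exact: measurable_fun_xsection.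
    - by move=> x _; rewrite gee0_abs //; apply: probability_le1; exact: measurable_xsection.
  by rewrite integral_cst // mul1e -ge0_fin_numE // fin_num_measure.
rewrite integral_normal_prob //.
transitivity (\int[mu]_x \int[mu]_u
    ((\1_A u * normal_pdf 0 1 u * normal_pdf (a * u) b x)%:E))%E.
  apply: eq_integral => x _; rewrite /= sectE -ge0_integralZr//.
  - apply: eq_integral => u _.
    by rewrite -!EFinM -mulrA [_ * normal_pdf 0 1 x]mulrC normal_pdf_rotation// mulrA.
  - apply: emeasurable_funM; apply/measurable_EFinP => //.
    exact: measurable_normal_pdf.
  - by move=> u _; rewrite mule_ge0 // lee_fin.
rewrite -(fubini_tonelli (m1 := mu) (m2 := mu)
  (fun z => (\1_A z.1 * normal_pdf 0 1 z.1 * normal_pdf (a * z.1) b z.2)%:E)) /=.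
- rewrite /normal_prob [RHS]integral_mkcond; apply: eq_integral => u _.
  transitivity (\int[mu]_y ((\1_A u * normal_pdf 0 1 u)%:E * (normal_pdf (a * u) b y)%:E))%E.
    by apply: eq_integral => y _; rewrite EFinM.
  rewrite ge0_integralZl//.
  + rewrite integral_normal_pdf mule1 patchE indicE.
    by case: ifPn => _; rewrite ?mul1r ?mul0r.
  + by apply/measurable_EFinP; exact: measurable_normal_pdf.
  + by rewrite lee_fin mulr_ge0// normal_pdf_ge0.
- apply/measurable_EFinP; apply: measurable_funM; last exact: measurable_normal_pdf2.
  apply: measurable_funM.
    exact: (measurableT_comp mind measurable_fst).
  by apply: measurableT_comp => //; exact: measurable_normal_pdf.
- by move=> z; rewrite lee_fin !mulr_ge0// normal_pdf_ge0.
Qed.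
End GaussianRotation.
Section LinearCombination.
Context (R : realType).
Local Notation gauss := (normal_prob (0 : R) 1).

(** The combination is written as [s] times a rotation of the pair. The law is
    expressed as an image of the standard one so that s = 0 is allowed. *)
Lemma gauss_prod_scale (r c : R) (A : set R) : 0 <= r -> measurable A ->
  (gauss \x gauss)%E ((fun z : R * R => r * z.1 + c * z.2) @^-1` A) =
  gauss ((fun z => Num.sqrt (r ^+ 2 + c ^+ 2) * z) @^-1` A).
Proof.
move=> r0 mA; set s := Num.sqrt _.
have mscaleA (t : R) : measurable ((fun z : R => t * z) @^-1` A).
  have mt : measurable_fun setT (fun z : R => t * z) by exact: measurable_funM.
  by rewrite -[X in measurable X]setTI; exact: (mt measurableT A mA).
have [c0|c0] := eqVneq c 0.
  have -> : (fun z : R * R => r * z.1 + c * z.2) @^-1` A = ((fun z => s * z) @^-1` A) `*` setT.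
    rewrite /s c0 expr0n addr0 sqrtr_sqr ger0_norm//.
    by apply/seteqP; split => -[x y] /=; rewrite mul0r addr0 // => -[].
  rewrite product_measure1E //; last exact: mscaleA.
  have g1 : gauss setT = 1%E by exact: probability_setT.
  by rewrite [X in (_ * X)%E]g1 mule1.
have s2 : s ^+ 2 = r ^+ 2 + c ^+ 2 by rewrite sqr_sqrtr// addr_ge0 ?sqr_ge0.
have s0 : s != 0.
  by rewrite -sqrf_eq0 s2 paddr_eq0 ?sqr_ge0 // !sqrf_eq0 (negbTE c0) andbF.
have cs0 : c / s != 0 by rewrite mulf_neq0// invr_eq0.
have rs1 : (r / s) ^+ 2 + (c / s) ^+ 2 = 1.
  by rewrite !exprMn -mulrDl -s2 exprVn divff// sqrf_eq0.
have <- := gauss_rotation cs0 rs1 (mscaleA s).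
have -> : (fun z : R * R => r * z.1 + c * z.2) =
    (fun z : R * R => s * (r / s * z.1 + c / s * z.2)).
  by apply/funext => z; field.
by [].
Qed.

Context d (T : measurableType d) (P : probability T R) (I : finType).
Variables (X : I -> T -> R) (c : I -> R).
Hypothesis Xnormal : forall i, std_normal P (X i).
Hypothesis Xindep : mutually_independent P X.

Let evt (K : {set I}) (B : I -> set R) := \bigcap_(i in [set` K]) X i @^-1` B i.

Let measurable_pre i (B : set R) : measurable B -> measurable (X i @^-1` B).
Proof.
by move=> mB; rewrite -[X in measurable X]setTI; apply: (Xnormal i).1.
Qed.

Let measurable_evt K B : (forall i, measurable (B i)) -> measurable (evt K B).
Proof.
move=> mB; apply: fin_bigcap_measurable; first exact: finite_finset.
by move=> i _; exact: measurable_pre.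
Qed.

Let evtU1 j (K : {set I}) (B : I -> set R) (B' : set R) : j \notin K ->
  evt (j |: K) (fun i => if i == j then B' else B i) = X j @^-1` B' `&` evt K B.
Proof.
move=> jK; apply/seteqP; split => w.
  move=> H; split.
    by have := H j; rewrite /= eqxx; apply; rewrite /= !inE eqxx.
  move=> i /= iK; have := H i; rewrite /= !inE iK orbT.
  by case: eqVneq => [ij|_]; [rewrite -ij iK in jK|apply].
move=> [Hj HK] i /=; rewrite !inE; case: eqVneq => [->//|_ /= iK].
exact: HK.
Qed.

Lemma measurable_lincomb (s : seq I) :
  measurable_fun setT (fun w => \sum_(i <- s) c i * X i w).
Proof.
apply: measurable_sum => i; apply: measurable_funM => //.
exact: (Xnormal i).1.
Qed.

(** The induction needs the independence of the partial sum from the remaining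
    variables, so it carries an arbitrary event of the variables in [K]. Adding
    one variable: the restricted joint law of the partial sum and of that
    variable agrees on rectangles with a product of normal laws, hence
    everywhere, and the product is known from [gauss_prod_scale]. *)
Lemma lincomb_indep (s : seq I) (K : {set I}) (A : set R) (B : I -> set R) :
  uniq s -> {in s, forall i, i \notin K} ->
  measurable A -> (forall i, measurable (B i)) ->
  P ((fun w => \sum_(i <- s) c i * X i w) @^-1` A `&` evt K B) =
  (gauss ((fun z => Num.sqrt (\sum_(i <- s) c i ^+ 2) * z)%R @^-1` A)
    * P (evt K B))%E.
Proof.
elim: s K A B => [|j s IH] K A B.
  move=> _ _ mA mB.
  have [A0|A0] := pselect (A 0).
    rewrite (_ : _ @^-1` A = setT) ?setTI; last first.
      by apply/seteqP; split => w //= _; rewrite big_nil.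
    have g1 : gauss setT = 1%E by exact: probability_setT.
    rewrite (_ : _ @^-1` A = setT); first by rewrite [X in (X * _)%E]g1 mul1e.
    by apply/seteqP; split => z //= _; rewrite big_nil sqrtr0 mul0r.
  rewrite (_ : _ @^-1` A = set0) ?set0I; last first.
    by apply/seteqP; split => w //=; rewrite big_nil.
  rewrite (_ : _ @^-1` A = set0) ?measure0 ?mul0e//.
  by apply/seteqP; split => z //=; rewrite big_nil sqrtr0 mul0r.
move=> /= /andP[js us] sK mA mB.
have jK : j \notin K by apply: sK; rewrite mem_head.
set S := fun w => \sum_(i <- s) c i * X i w.
set r := Num.sqrt (\sum_(i <- s) c i ^+ 2).
have r0 : 0 <= r by exact: sqrtr_ge0.
have mSX : measurable_fun setT (fun w => (S w, X j w)).
  by apply: measurable_fun_pair; [exact: measurable_lincomb|exact: (Xnormal j).1].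
have mphi : measurable_fun setT (fun z : R * R => (r * z.1, z.2)).
  by apply: measurable_fun_pair => //; exact: measurable_funM.
have mF := measurable_evt K mB.
pose k := NngNum (fine_ge0 (measure_ge0 P (evt K B))).
have kE : (k%:num)%:E = P (evt K B) by rewrite /= fineK// fin_num_measure.
pose m1 := image_measure (mrestr P mF) mSX.
pose m2 := image_measure (mscale k (gauss \x gauss)%E) mphi.
have m12 E : measurable E -> m1 E = m2 E.
  apply: (measure_unique
    [set A `*` B | A in @measurable _ R & B in @measurable _ R] (fun=> setT)).
  - by rewrite measurable_prod_measurableType.
  - move=> _ _ [A1 mA1 [B1 mB1 <-]] [A2 mA2 [B2 mB2 <-]].
    exists (A1 `&` A2); first exact: measurableI.
    by exists (B1 `&` B2); [exact: measurableI|rewrite setXI].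
  - by move=> _; exists setT => //; exists setT => //; rewrite setXTT.
  - by apply/seteqP; split => // x _; exists 0%N.
  - move=> _ [A1 mA1 [B1 mB1 <-]].
    transitivity (P (S @^-1` A1 `&` evt (j |: K) (fun i => if i == j then B1 else B i))).
      by rewrite evtU1// setIA.
    rewrite IH//; last 2 first.
    + move=> i si; rewrite !inE negb_or sK ?in_cons ?si ?orbT// andbT.
      by apply: contraNneq js => <-.
    + by move=> i; case: ifP.
    transitivity (P (evt K B) *
      (gauss ((fun z : R => (r * z)%R) @^-1` A1) * gauss B1))%E; last first.
      rewrite /m2 /= /pushforward /mscale -kE; congr (_ * _)%E.
      rewrite -product_measure1E//.
      have mr : measurable_fun setT (fun z : R => r * z) by exact: measurable_funM.
      by rewrite -[X in measurable X]setTI; exact: (mr measurableT A1 mA1).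
    rewrite muleCA; congr (_ * _)%E.
    rewrite Xindep; last by move=> i; case: ifP.
    rewrite big_setU1//= eqxx (Xnormal j).2// muleC; congr (_ * _)%E.
    rewrite [RHS]Xindep//; apply: eq_bigr => i iK.
    by case: eqVneq => // ij; rewrite -ij iK in jK.
  - move=> _; have -> : m1 setT = P (evt K B).
      by rewrite /m1 /= /pushforward /mrestr preimage_setT setTI.
    by rewrite -kE ltry.
rewrite big_cons.
have mlin : measurable_fun setT (fun z : R * R => z.1 + c j * z.2).
  by apply: measurable_funD => //; exact: measurable_funM.
have mE : measurable ((fun z : R * R => z.1 + c j * z.2) @^-1` A).
  by rewrite -[X in measurable X]setTI; exact: (mlin measurableT A mA).
transitivity (m1 ((fun z : R * R => z.1 + c j * z.2) @^-1` A)).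
  rewrite /m1 /= /pushforward /mrestr; congr (P (_ `&` _)).
  by apply/seteqP; split => w /=; rewrite big_cons addrC.
rewrite m12// /m2 /= /pushforward /mscale muleC -kE; congr (_ * _)%E.
transitivity ((gauss \x gauss)%E ((fun z : R * R => r * z.1 + c j * z.2) @^-1` A)) => //.
have r2 : r ^+ 2 = \sum_(i <- s) c i ^+ 2.
  by rewrite sqr_sqrtr//; apply: sumr_ge0 => i _; exact: sqr_ge0.
have -> : c j ^+ 2 + \sum_(i <- s) c i ^+ 2 = r ^+ 2 + c j ^+ 2 by rewrite r2 addrC.
exact: gauss_prod_scale.
Qed.

Lemma std_normal_lincomb : \sum_i c i ^+ 2 = 1 ->
  std_normal P (fun w => \sum_i c i * X i w).
Proof.
move=> c1; split; first exact: measurable_lincomb.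
move=> A mA; have := @lincomb_indep (index_enum I) finset.set0 A (fun=> setT).
rewrite /evt (_ : \bigcap_(i in _) _ = setT); last first.
  by apply/seteqP; split => // w _ i.
rewrite setIT probability_setT mule1 c1 sqrtr1 => ->//.
- by rewrite /preimage /=; congr (gauss _); apply/seteqP; split => z /=; rewrite mul1r.
- exact: index_enum_uniq.
- by move=> i; rewrite inE.
Qed.

End LinearCombination.
(** * Measurability of the statistic *)

Section LipschitzMeasurability.
Context (R : realType) (k : nat).
Local Notation V := (symmat R k).

Definition rat_point (q : {ffun upper_index k -> rat}) : V :=
  \sum_p ratr (q p) *: basis_sym R p.

Lemma frob_norm_basis p : frob_norm (basis_sym R p : V) = 1.
Proof. by rewrite /frob_norm basis_orthonormal eqxx sqrtr1. Qed.

Lemma rat_point_dense (X : V) (e : R) : 0 < e ->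
  exists q, frob_norm (X - rat_point q) < e.
Proof.
move=> e0; pose N := #|{: upper_index k}|; pose d := e / N.+1%:R.
have d0 : 0 < d by rewrite divr_gt0.
have approx (x : R) : {q : rat | `|x - ratr q| < d}.
  apply: cid; have [|q] := @rat_in_itvoo R (x - d) (x + d); first by lra.
  by rewrite in_itv /= => /andP[h1 h2]; exists q; rewrite ltr_norml; lra.
pose q := [ffun p => sval (approx (frob_dot (basis_sym R p) X))].
exists q; rewrite [X in frob_norm (X - _)](basis_expand X) -sumrB.
apply: (le_lt_trans (frob_norm_sum _ _)).
apply: (@le_lt_trans _ _ (\sum_(p : upper_index k) d)).
  apply: ler_sum => p _; rewrite -scalerBl frob_normZ frob_norm_basis mulr1 ffunE.
  by apply: ltW; case: (approx _).
rewrite sumr_const -mulr_natr.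
have eE : d * N.+1%:R = e by rewrite divfK// pnatr_eq0.
by rewrite -[ltRHS]eE ltr_pM2l// ltr_nat.
Qed.

Context d (T : measurableType d) (Y : T -> V).
Hypothesis mY : forall p, measurable_fun setT (fun w => frob (sym_basis R p) (mat_of (Y w))).

Lemma measurable_frob_dist (Z : V) : measurable_fun setT (fun w => frob_norm (Y w - Z)).
Proof.
rewrite (_ : (fun w => _) = Num.sqrt \o (fun w => \sum_p
    (frob (sym_basis R p) (mat_of (Y w)) - frob (sym_basis R p) (mat_of Z)) ^+ 2)); last first.
  apply/funext => w; rewrite /frob_norm frob_dot_coord; apply: (congr1 Num.sqrt).
  apply: eq_bigr => p _; rewrite -expr2.
  have coord X : frob (sym_basis R p) (mat_of X) = frob_dot (basis_sym R p) X.
    by rewrite /frob_dot basis_symE.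
  by rewrite !coord frob_dotBr.
apply: measurableT_comp.
  by apply: continuous_measurable_fun; exact: sqrt_continuous.
by apply: measurable_sum => p; apply: measurable_funX; apply: measurable_funB.
Qed.

(** A 1-Lipschitz [f] is the infimum of X |-> |X - q| + f q over the countable
    dense set of rational points, so its sublevel sets are countable unions of
    events that only involve the coordinates. *)
Lemma measurable_lipschitz (f : V -> R) :
  (forall X Z, f X <= frob_norm (X - Z) + f Z) ->
  measurable_fun setT (fun w => f (Y w)).
Proof.
move=> lip; apply: (measurability _ (RGenInftyO.measurableE R)) => _ [_ [t ->] <-].
rewrite setTI.
rewrite (_ : _ @^-1` _ = \bigcup_(q : {ffun upper_index k -> rat})
    (fun w => frob_norm (Y w - rat_point q) + f (rat_point q)) @^-1`
      `]-oo, t[%classic); last first.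
  apply/seteqP; split => w /=; rewrite in_itv /= => h.
    have [|q hq] := rat_point_dense (Y w) (e := (t - f (Y w)) / 2).
      by rewrite divr_gt0// subr_gt0.
    exists q => //=; rewrite in_itv /=.
    have := lip (rat_point q) (Y w); rewrite frob_norm_distC; lra.
  case: h => q _ /=; rewrite in_itv /=; exact: le_lt_trans.
apply: countable_bigcupT_measurable; first exact: countableP.
move=> q; rewrite -[X in measurable X]setTI.
have mq : measurable_fun setT (fun w => frob_norm (Y w - rat_point q) + f (rat_point q)).
  by apply: measurable_funD => //; exact: measurable_frob_dist.
by apply: (mq measurableT); exact: measurable_itv.
Qed.

Lemma measurable_dist (A : set V) (mu : V) : A !=set0 ->
  measurable_fun setT (fun w => dist_F (Y w + mu) A).
Proof.
move=> A0; apply: (measurable_lipschitz (f := fun X => dist_F (X + mu) A)) => X Z.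
by rewrite (le_trans (dist_lipschitz _ (Z + mu) A0))// opprD addrACA subrr addr0.
Qed.

End LipschitzMeasurability.

(** * The one-dimensional stratum *)

(** On 1 x 1 matrices [S^{-1/2}] is a positive scaling, so the cone is a
    half-line and its boundary the origin, whatever [S]. *)
Lemma lr_stat_dim1 (R : realType) (k m : nat) (S : 'End(symmat R k))
    (p : upper_index k) (X : symmat R k) :
  k = 1%N -> m = 0%N -> self_adjoint S -> positive_definite S ->
  lr_stat m S X = pos_part (frob (sym_basis R p) (mat_of X)) ^+ 2.
Proof.
move=> k1 m0 S_sa S_pd; subst k m.
have k0 : (0 < 1)%N by []. have km1 : (1 - 0 = 1)%N by [].
pose x (X : symmat R 1) := mat_of X 0 0.
have -> : frob (sym_basis R p) (mat_of X) = x X.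
  by rewrite coordE /coord_weight (ord1 (val p).1) (ord1 (val p).2) eqxx mul1r.
have dotE Y Z : frob_dot Y Z = x Y * x Z by rewrite /frob_dot frobE !big_ord1.
have x0 Y : x Y = 0 -> Y = 0.
  by move=> Y0; apply/eqP; rewrite -frob_dot_eq0 dotE Y0 mul0r.
have xpsd Y : psd_cone Y <-> 0 <= x Y.
  split=> [/(_ (const_mx 1))|Y0 v].
    by rewrite mxE big_ord1 !mxE big_ord1 !mxE mul1r mulr1.
  rewrite mxE big_ord1 mxE big_ord1 !mxE -/(x Y) mulrAC -expr2.
  by rewrite mulr_ge0// sqr_ge0.
have sgn Y : Y != 0 -> 0 < x (sqrt_op S Y) * x Y.
  move=> Y0; rewrite -dotE -{2}(sqrt_opK S_sa S_pd Y) frob_dotC.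
  have [_ pd _] := inv_sqrtP S_sa S_pd; apply: pd.
  by apply: contra_neq Y0 => Y0; rewrite -(sqrt_opK S_sa S_pd Y) Y0 linear0.
have CE Y : cone_C S Y <-> 0 <= x Y.
  rewrite (cone_CE S_sa S_pd) xpsd; have [->|/sgn] := eqVneq Y 0.
    by rewrite /sqrt_op !linear0.
  by move=> h; split => h'; nra.
have DE : cone_D 0 S = [set 0].
  apply/seteqP; split => Y; last by move=> ->; exact: cone_D0.
  move=> /(cone_DE k0 km1 S_sa S_pd)[_ /singular_kernelP[v v0 Yv]] /=.
  rewrite -(sqrt_opK S_sa S_pd Y) (x0 (sqrt_op S Y)) ?linear0//.
  have := congr1 (fun M : 'cV[R]_1 => M 0 0) Yv; rewrite !mxE big_ord1 => /eqP.
  rewrite mulf_eq0 => /orP[/eqP//|/eqP v00]; case/negP: v0; apply/eqP/colP => i.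
  by rewrite !ord1 mxE.
rewrite /lr_stat /pos_part; have [xX|xX] := leP 0 (x X).
  rewrite (dist_mem (proj2 (CE X) xX)) expr0n subr0 DE dist_set1 subr0.
  by rewrite frob_normE dotE -expr2.
rewrite (dist_outside k0 km1 S_sa S_pd) ?subrr ?expr0n//.
by move=> /CE; rewrite leNgt xX.
Qed.

(** * Stochastic domination *)

Section Assembly.
Context (R : realType).

Lemma measurable_pos_part_sqr d (T : measurableType d) (X : T -> R) :
  measurable_fun setT X -> measurable_fun setT (fun w => pos_part (X w) ^+ 2).
Proof. by move=> mX; apply: measurable_funX; apply: measurable_maxr. Qed.

Lemma pos_part_sqr_same_law d (T : measurableType d) (P : probability T R) (X : T -> R)
    d' (T' : measurableType d') (P' : probability T' R) (X' : T' -> R) :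
  std_normal P X -> std_normal P' X' ->
  same_law P (fun w => pos_part (X w) ^+ 2) P' (fun w => pos_part (X' w) ^+ 2).
Proof.
move=> [mX PX] [mX' PX']; split; [exact: measurable_pos_part_sqr..|].
move=> A mA; pose g (x : R) := pos_part x ^+ 2.
have mg : measurable (g @^-1` A).
  have mg : measurable_fun setT g by exact: measurable_pos_part_sqr.
  by rewrite -[X in measurable X]setTI; exact: (mg measurableT A mA).
transitivity (P (X @^-1` (g @^-1` A))) => //.
by rewrite PX// -PX'.
Qed.

Lemma std_gaussian_unit_functional d (T : measurableType d) (P : probability T R) k
    (Y : T -> symmat R k) (n : symmat R k) :
  std_gaussian P Y -> frob_dot n n = 1 ->
  std_normal P (fun w => frob_dot n (Y w)).
Proof.
move=> [Yn Yi] n1.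
under eq_fun do rewrite frob_dot_coord.
apply: (std_normal_lincomb Yn Yi).
by rewrite -n1 frob_dot_coord; apply: eq_bigr => p _; rewrite expr2.
Qed.

(** A pointwise bound on one probability space by a variable with the law of [X']
    gives both the coupling and the domination. *)
Lemma same_law_le_dominated d (T : measurableType d) (P : probability T R) (U V : T -> R)
    d' (T' : measurableType d') (P' : probability T' R) (X' : T' -> R) :
  measurable_fun setT U -> same_law P V P' X' -> (forall w, U w <= V w) ->
  st_le P U P' X' /\ coupled_le P U P' X'.
Proof.
move=> mU [mV mX' VX'] UV; split; last first.
  exists d, T, P, U, V; split => //.
  by apply: aeW => w.
split => // t.
have mray (W : T -> R) : measurable_fun setT W -> measurable [set w | t < W w].
  move=> mW; rewrite -[X in measurable X]setTI.
  have := mW measurableT `]t, +oo[%classic (measurable_itv _).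
  by congr (measurable (_ `&` _)); apply/seteqP; split => w /=; rewrite in_itv /= andbT.
have -> : P' [set w | t < X' w] = P [set w | t < V w].
  have /esym := VX' `]t, +oo[%classic (measurable_itv _).
  by congr (P' _ = P _); apply/seteqP; split => w /=; rewrite in_itv /= andbT.
apply: le_measure; rewrite ?inE; [exact: mray..|].
by move=> w /= tU; exact: lt_le_trans (UV w).
Qed.

Lemma lr_stat_dominated (k m : nat) (S : 'End(symmat R k)) (mu : symmat R k)
    d (T : measurableType d) (P : probability T R) (Y : T -> symmat R k)
    d' (T' : measurableType d') (P' : probability T' R) (Z : T' -> R) :
  (0 < k)%N -> (k - m = 1)%N -> self_adjoint S -> positive_definite S ->
  cone_D m S mu -> std_gaussian P Y -> std_normal P' Z ->
  st_le P (fun w => lr_stat m S (Y w + mu)) P' (fun w => pos_part (Z w) ^+ 2) /\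
  coupled_le P (fun w => lr_stat m S (Y w + mu)) P' (fun w => pos_part (Z w) ^+ 2).
Proof.
move=> k0 km1 Ssa Spd Dmu hY hZ.
have [n n1 le_n] := lr_stat_le k0 km1 Ssa Spd Dmu.
have hn := std_gaussian_unit_functional hY n1.
apply: (same_law_le_dominated (V := fun w => pos_part (frob_dot n (Y w)) ^+ 2)).
- have mY p := (hY.1 p).1.
  apply: measurable_funB; apply: measurable_funX; apply: measurable_dist => //.
    by exists mu.
  by exists mu; exact: (cone_D_sub_C k0 km1 Ssa Spd Dmu).
- exact: pos_part_sqr_same_law.
- by move=> w; exact: le_n.
Qed.

End Assembly.

Theorem proposition3p12 (R : realType) :
  (forall (k m : nat) (hk : (1 <= k)%N) (hkm : (k - m = 1)%N)
      (S : 'End(symmat R k)) (hS : self_adjoint S) (hS0 : positive_definite S),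
    cone_D m S = sym_boundary (cone_C S) /\
    forall (mu : symmat R k) (hmu : cone_D m S mu)
      (d : measure_display) (T : measurableType d) (P : probability T R)
      (Y : T -> symmat R k) (hY : std_gaussian P Y)
      (d' : measure_display) (T' : measurableType d') (P' : probability T' R)
      (Z : T' -> R) (hZ : std_normal P' Z),
      st_le P (fun w => lr_stat m S (Y w + mu))
            P' (fun w => pos_part (Z w) ^+ 2) /\
      coupled_le P (fun w => lr_stat m S (Y w + mu))
                 P' (fun w => pos_part (Z w) ^+ 2))
  /\
  (forall (q r : nat) (hqr : (q - r = 1)%N)
      (* the top stratum s = r: k = q - r, m = r - r, zero drift *)
      (S0 : 'End(symmat R (q - r)))
      (hS0 : self_adjoint S0) (hS00 : positive_definite S0)
      (d0 : measure_display) (T0 : measurableType d0) (P0 : probability T0 R)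
      (Y0 : T0 -> symmat R (q - r)) (hY0 : std_gaussian P0 Y0),
    (forall (s : nat) (hs : (s <= r)%N)
        (S : 'End(symmat R (q - s)))
        (hS : self_adjoint S) (hSp : positive_definite S)
        (mu : symmat R (q - s)) (hmu : cone_D (r - s) S mu)
        (d : measure_display) (T : measurableType d) (P : probability T R)
        (Y : T -> symmat R (q - s)) (hY : std_gaussian P Y),
      st_le P (fun w => lr_stat (r - s) S (Y w + mu))
            P0 (fun w => lr_stat (r - r) S0 (Y0 w + 0))) /\
    (forall (d' : measure_display) (T' : measurableType d')
        (P' : probability T' R) (Z : T' -> R) (hZ : std_normal P' Z),
      same_law P0 (fun w => lr_stat (r - r) S0 (Y0 w + 0))
               P' (fun w => pos_part (Z w) ^+ 2))).
Proof.
split=> [k m hk hkm S hS hS0|q r hqr S0 hS0 hS00 d0 T0 P0 Y0 hY0].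
  split; first exact: cone_D_boundary.
  by move=> mu hmu d T P Y hY d' T' P' Z hZ; exact: lr_stat_dominated.
have k0 : (0 < q - r)%N by rewrite hqr.
pose p : upper_index (q - r) :=
  exist (fun p : 'I_(q - r) * 'I_(q - r) => (p.1 <= p.2)%N)
    (Ordinal k0, Ordinal k0) (leqnn 0).
have statE : (fun w => lr_stat (r - r) S0 (Y0 w + 0)) =
    (fun w => pos_part (frob (sym_basis R p) (mat_of (Y0 w))) ^+ 2).
  by apply/funext => w; rewrite addr0; apply: lr_stat_dim1 => //; rewrite subnn.
rewrite statE; split=> [s hs S hS hSp mu hmu d T P Y hY|d' T' P' Z hZ].
  apply: (lr_stat_dominated _ _ hS hSp hmu hY (hY0.1 p)).1; lia.
exact: pos_part_sqr_same_law (hY0.1 p) hZ.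
Qed.
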